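(* Let $\alpha\in\mathbb{R}$, $0<\gamma<1$, $1<p\leq\infty$, and let $q$ be the exponent conjugate to $p$. Let $f\in H(\mathbb{D})$ be a $\mathcal{U}_{\beta^\gamma}$-frequently hypercyclic function for $T_\alpha$. Then - if $\alpha<\frac{1-\gamma}{\max(2,q)}$, then $\limsup_{r\to1^-}\big((1-r)^{\frac{1-\gamma}{\max(2,q)}-\alpha}M_p(f,r)\big)>0$; - if $\alpha=\frac{1-\gamma}{\max(2,q)}$, then $\limsup_{r\to1^-}M_p(f,r)=+\infty$; - if $\alpha>\frac{1-\gamma}{\max(2,q)}$, then $\limsup_{r\to1^-}M_p(f,r)>0$.
   Context: $\mathbb{D}$ is the open unit disc in $\mathbb{C}$ and $H(\mathbb{D})$ is the Fréchet space of analytic functions on $\mathbb{D}$ with the topology of uniform convergence on compact subsets. For $\alpha\in\mathbb{R}$ and $n\ge1$ put $w_n(\alpha)=(1+\frac1n)^{\alpha}$; the weighted Taylor shift $T_\alpha:H(\mathbb{D})\to H(\mathbb{D})$ is $T_\alpha\big(\sum_{k\ge0}a_kz^k\big)=\sum_{k\ge0}a_{k+1}w_{k+1}(\alpha)z^k$. For $0\le\gamma\le1$ and $E\subset\mathbb{N}$, the upper $\beta^\gamma$-density is $\overline d_{\beta^\gamma}(E)=\limsup_{n\to\infty}\frac{\sum_{1\le k\le n,\,k\in E}e^{k^\gamma}}{\sum_{k=1}^ne^{k^\gamma}}$. A function $f\in H(\mathbb{D})$ is $\mathcal{U}_{\beta^\gamma}$-frequently hypercyclic for $T_\alpha$ if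 for every non-empty open set $U\subset H(\mathbb{D})$, $\overline d_{\beta^\gamma}(\{n\in\mathbb{N}:T_\alpha^nf\in U\})>0$. For $0<r<1$, $M_p(f,r)=\big(\frac1{2\pi}\int_0^{2\pi}|f(re^{i\theta})|^p\,d\theta\big)^{1/p}$ if $1\le p<\infty$, and $M_\infty(f,r)=\sup_{0\le t\le2\pi}|f(re^{it})|$. The conjugate exponent $q$ satisfies $\frac1p+\frac1q=1$ ($q=1$ if $p=\infty$). *)

(* Defs.v *)
From HB Require Import structures.
From mathcomp Require Import all_boot all_order all_algebra.
From mathcomp Require Import all_classical all_reals all_analysis.
From mathcomp Require Import complex.

Set Implicit Arguments.
Unset Strict Implicit.
Unset Printing Implicit Defensive.

Import Order.TTheory GRing.Theory Num.Theory.
Import numFieldNormedType.Exports.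

Local Open Scope classical_set_scope.
Local Open Scope ring_scope.
Local Open Scope complex_scope.

(* The regular module [R[i]^o] is the alias of [R[i]] that carries the
   topological and normed-module structures. *)
Notation CC R := (R[i]^o).

Definition disc (R : realType) : set (CC R) := [set z | `|z| < 1].

(* Elements of H(D) are represented by total functions on the plane; values
   outside the disc are unconstrained and play no role. *)
Definition HD (R : realType) : set (CC R -> CC R) :=
  [set f | forall z, @disc R z -> derivable f z 1].

(* Open sets of H(D): traces on [HD] of open sets of this space. *)
Definition cvg_on_compacts (R : realType) : topologicalType :=
  {family compactly_in (@disc R), CC R -> CC R}.

Definition has_expansion (R : realType) (f : CC R -> CC R) (a : nat -> CC R) :
    Prop :=
  forall z, @disc R z -> series (fun k => a k * z ^+ k) @ \oo --> f z.

Definition weight (R : realType) (alpha : R) (n : nat) : R :=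
  (1 + n%:R^-1) `^ alpha.

(* The value is determined on the disc by uniqueness of power series
   coefficients.  The default [fun=> 0] of [xget] is never used for [f] in
   [HD], as every such [f] has an expansion on the disc. *)
Definition taylor_shift (R : realType) (alpha : R) (f : CC R -> CC R) :
    CC R -> CC R :=
  xget (fun=> 0) [set g | exists2 a, has_expansion f a &
    has_expansion g (fun k => a k.+1 * (weight alpha k.+1)%:C)].

Definition upper_beta_density (R : realType) (gamma : R) (E : set nat) :
    \bar R :=
  limn_esup (fun n =>
    ((\sum_(1 <= k < n.+1 | k \in E) expR (k%:R `^ gamma)) /
     (\sum_(1 <= k < n.+1) expR (k%:R `^ gamma)))%:E).

Definition U_beta_frequently_hypercyclic (R : realType) (gamma : R)
    (T : (CC R -> CC R) -> (CC R -> CC R)) (f : CC R -> CC R) : Prop :=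
  @HD R f /\
  forall O : set (cvg_on_compacts R), open O -> @HD R `&` O !=set0 ->
    (0 < upper_beta_density gamma [set n | (@HD R `&` O) (iter n T f)])%E.

Definition circle_point (R : realType) (r t : R) : CC R :=
  (r * cos t) +i* (r * sin t).

(* Meaningful for [1 <= p <= +oo]. *)
Definition integral_mean (R : realType) (p : \bar R) (f : CC R -> CC R)
    (r : R) : \bar R :=
  match p with
  | p'%:E =>
      (((2 * pi)^-1%:E *
        \int[lebesgue_measure]_(t in `[0%R, (2 * pi)%R])
           ((Normc.normc (f (circle_point r t)) `^ p')%:E)) `^ p'^-1)%E
  | +oo%E =>
      ereal_sup [set (Normc.normc (f (circle_point r t)))%:E |
                 t in `[0%R, (2 * pi)%R]]
  | -oo%E => 0%E
  end.

(* Main.v *)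
Require Import Defs.
From mathcomp Require Import all_boot all_order all_algebra.
From mathcomp Require Import all_classical all_reals all_analysis.
From mathcomp Require Import measurable_realfun complex ring lra.
Set Implicit Arguments.
Unset Strict Implicit.
Unset Printing Implicit Defensive.
Import Order.TTheory GRing.Theory Num.Theory.
Import numFieldNormedType.Exports.
Local Open Scope classical_set_scope.
Local Open Scope ring_scope.
Local Open Scope complex_scope.
Local Notation Re := complex.Re.
Local Notation Im := complex.Im.
Local Notation normc := Normc.normc.

(** Write [Q = max(2, q)], let [P] be its conjugate exponent, so that [P <= 2] and
    [P <= p], and let [a] be the Taylor coefficients of [f] at [0].

    Since the weights telescope, [T ^ n f (0) = (n + 1) ^ alpha a_n].  Visiting the
    open set of all [g] with [|g(0) - 2| < 1] therefore forces
    [|a_n| >= (n + 1) ^ (- alpha)], and hypercyclicity says that this happens on a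
    set [E] of positive upper density for the weights [exp (k ^ gamma)].  These
    weights are concentrated near the top: below [N], the last [N ^ (1 - gamma)]
    of them are comparable to [exp (N ^ gamma)], and the first half of them is
    negligible.  Hence for infinitely many [N] the block [(N / 2, N]] contains at
    least [c N ^ (1 - gamma)] elements of [E] ([beta_dense_block]).

    The lower bounds on the means come from duality.  For a trigonometric
    polynomial with coefficients [c_k], the average over the circle of
    [Re (f (r e^{it}) conj (sum c_k e^{ikt}))] is [sum r ^ k Re (a_k conj c_k)]
    ([expansion_pairing]), and the inequality of Young bounds this pairing by
    [avg |f| ^ P] plus [avg |sum c_k e^{ikt}| ^ Q] ([pairing_young]).  On a block
    with [m] good indices, take [|c_k| = m ^ (- 1 / P)] with the phases of the
    [a_k].  The polynomial is bounded by [m ^ (1 / Q)] and has mean square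
    [m ^ (1 - 2 / P)], so its [L^Q] norm is at most [1].  The pairing is at least a constant times
    [m ^ (1 / Q) N ^ (- alpha)], that is [N ^ ((1 - gamma) / Q - alpha)], as soon
    as [r >= 1 - 1 / (2 N)] ([block_poly]).  This gives the power growth.

    At the critical exponent every block contributes a constant to the pairing,
    and one adds the test polynomials of [J] blocks ([multi_block_poly]).  The
    pairing grows like [J].  If [Q > 2], a block polynomial with large [N] has a
    tiny [L^2] norm, hence is large only on a tiny set, and the [Q]-th powers of
    the [L^Q] norms add up to a bounded error; if [Q = 2] they add up exactly by
    the formula of Parseval.  So both [J] and the [Q]-th power of the norm grow
    linearly, and Young's inequality shows that bounded means are impossible.

    Above the critical exponent a single non-zero coefficient suffices. *)

(** * Averages over the circle *)

(** This class is stable under all the operations used below, and every member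
    is integrable on a bounded interval, so the average is linear on it. *)
Definition bounded_measurable (R : realType) (h : R -> R) : Prop :=
  measurable_fun setT h /\ exists B, forall t, `|h t| <= B.

Definition circle_avg (R : realType) (h : R -> R) : R :=
  (2 * pi)^-1 * \int[lebesgue_measure]_(t in `[0, 2 * pi]) h t.

Section bounded_measurable.
Variable R : realType.
Implicit Types (h g : R -> R) (c : R).

Lemma bounded_measurable_cst c : bounded_measurable (fun _ : R => c).
Proof. by split; [exact: measurable_cst | exists `|c|]. Qed.

Lemma bounded_measurableD h g : bounded_measurable h -> bounded_measurable g ->
  bounded_measurable (fun t => h t + g t).
Proof.
move=> [mh [B hB]] [mg [D gD]]; split; first exact: measurable_funD.
exists (B + D) => t; rewrite (le_trans (ler_normD _ _))//.
exact: lerD.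
Qed.

Lemma bounded_measurableM h g : bounded_measurable h -> bounded_measurable g ->
  bounded_measurable (fun t => h t * g t).
Proof.
move=> [mh [B hB]] [mg [D gD]]; split; first exact: measurable_funM.
by exists (B * D) => t; rewrite normrM ler_pM.
Qed.

Lemma bounded_measurableZ c h : bounded_measurable h ->
  bounded_measurable (fun t => c * h t).
Proof. exact/bounded_measurableM/bounded_measurable_cst. Qed.

Lemma bounded_measurableN h : bounded_measurable h ->
  bounded_measurable (fun t => - h t).
Proof.
move=> bh; have := bounded_measurableZ (-1) bh.
by under eq_fun do rewrite mulN1r.
Qed.

Lemma bounded_measurableB h g : bounded_measurable h -> bounded_measurable g ->
  bounded_measurable (fun t => h t - g t).
Proof. by move=> bh bg; exact/bounded_measurableD/bounded_measurableN. Qed.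

Lemma bounded_measurable_powR h c : bounded_measurable h -> 0 <= c ->
  (forall t, 0 <= h t) -> bounded_measurable (fun t => h t `^ c).
Proof.
move=> [mh [B hB]] c0 h0; split.
  exact: (measurableT_comp (measurable_powR c) mh).
exists (B `^ c) => t; rewrite ger0_norm ?powR_ge0// ge0_ler_powR//.
- by rewrite nnegrE.
- by rewrite nnegrE (le_trans _ (hB t)).
- by rewrite -(ger0_norm (h0 t)).
Qed.

Lemma bounded_measurable_sum (I : Type) (s : seq I) (F : I -> R -> R) :
  (forall i, bounded_measurable (F i)) ->
  bounded_measurable (fun t => \sum_(i <- s) F i t).
Proof.
move=> bF; elim: s => [|i s IH].
  by under eq_fun do rewrite big_nil; exact: bounded_measurable_cst.
under eq_fun do rewrite big_cons.
exact: bounded_measurableD.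
Qed.

Lemma bounded_measurable_cos c : bounded_measurable (fun t => cos (c * t)).
Proof.
split; last by exists 1 => t; rewrite ler_norml cos_geN1 cos_le1.
apply: measurable_funTS; apply: continuous_measurable_fun => t.
by apply: continuous_comp; [exact: mulrl_continuous | exact: continuous_cos].
Qed.

Lemma bounded_measurable_sin c : bounded_measurable (fun t => sin (c * t)).
Proof.
split; last by exists 1 => t; rewrite ler_norml sin_geN1 sin_le1.
apply: measurable_funTS; apply: continuous_measurable_fun => t.
by apply: continuous_comp; [exact: mulrl_continuous | exact: continuous_sin].
Qed.

Lemma twopi_gt0 : 0 < 2 * pi :> R.
Proof. by rewrite mulr_gt0 ?pi_gt0. Qed.

Lemma bounded_measurable_integrable h : bounded_measurable h ->
  lebesgue_measure.-integrable `[0, 2 * pi] (EFin \o h).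
Proof.
move=> [mh [B hB]]; apply: measurable_bounded_integrable => //.
- by rewrite /= lebesgue_measure_itv/= lte_fin twopi_gt0 -EFinB ltry.
- exact: measurable_funTS.
- exists B; split; first exact: num_real.
  by move=> M BM t _; apply: le_trans (hB t) (ltW BM).
Qed.

Lemma circle_avgD h g : bounded_measurable h -> bounded_measurable g ->
  circle_avg (fun t => h t + g t) = circle_avg h + circle_avg g.
Proof.
move=> bh bg; rewrite /circle_avg RintegralD//; [by rewrite mulrDr| |];
  exact: bounded_measurable_integrable.
Qed.

Lemma circle_avgZ c h : bounded_measurable h ->
  circle_avg (fun t => c * h t) = c * circle_avg h.
Proof.
move=> bh; rewrite /circle_avg RintegralZl//; first by rewrite mulrCA.
exact: bounded_measurable_integrable.
Qed.

Lemma circle_avgB h g : bounded_measurable h -> bounded_measurable g ->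
  circle_avg (fun t => h t - g t) = circle_avg h - circle_avg g.
Proof.
move=> bh bg; rewrite /circle_avg RintegralB//; [by rewrite mulrBr| |];
  exact: bounded_measurable_integrable.
Qed.

Lemma circle_avg_cst c : circle_avg (fun=> c) = c.
Proof.
rewrite /circle_avg Rintegral_cst//= lebesgue_measure_itv/= lte_fin twopi_gt0/=.
by rewrite subr0 mulrC mulfK// gt_eqF// twopi_gt0.
Qed.

Lemma le_circle_avg h g : bounded_measurable h -> bounded_measurable g ->
  (forall t, t \in `[0, 2 * pi] -> h t <= g t) -> circle_avg h <= circle_avg g.
Proof.
move=> bh bg hg; rewrite ler_wpM2l ?invr_ge0 ?(ltW twopi_gt0)//.
by apply: le_Rintegral => //; exact: bounded_measurable_integrable.
Qed.

Lemma circle_avg_ge0 h : (forall t, 0 <= h t) -> 0 <= circle_avg h.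
Proof.
move=> h0; rewrite mulr_ge0 ?invr_ge0 ?(ltW twopi_gt0)//.
by apply: Rintegral_ge0 => t _.
Qed.

Lemma circle_avg_sum (I : Type) (s : seq I) (F : I -> R -> R) :
  (forall i, bounded_measurable (F i)) ->
  circle_avg (fun t => \sum_(i <- s) F i t) = \sum_(i <- s) circle_avg (F i).
Proof.
move=> bF; elim: s => [|i s IH].
  by under eq_fun do rewrite big_nil; rewrite big_nil circle_avg_cst.
under eq_fun do rewrite big_cons.
by rewrite circle_avgD ?IH ?big_cons//; exact: bounded_measurable_sum.
Qed.

(** A periodic primitive kills the average, by the fundamental theorem of
    calculus; applied below to the sine and cosine of a non-zero integer
    frequency. *)
Lemma circle_avg_derivative (F h : R -> R) : continuous h ->
  (forall t : R, is_derive t 1 F (h t)) -> F (2 * pi) = F 0 ->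
  circle_avg h = 0.
Proof.
move=> ch dF F2pi; rewrite /circle_avg /Rintegral.
have cF : continuous F.
  move=> t; apply: differentiable_continuous.
  by apply/derivable1_diffP; have [] := dF t.
rewrite (@continuous_FTC2 _ h F 0 (2 * pi) twopi_gt0).
- by rewrite F2pi -EFinB subrr /= mulr0.
- exact: continuous_subspaceT.
- split.
  + by move=> t _; have [] := dF t.
  + by apply: cvg_at_right_filter; exact: cF.
  + by apply: cvg_at_left_filter; exact: cF.
- by move=> t _; rewrite derive1E; have [] := dF t.
Qed.

Lemma sin_natr2pi n : sin (n%:R * (2 * pi)) = 0 :> R.
Proof.
by rewrite !mulr_natl -[_ *+ n]add0r (periodicn (@sinD2pi R)) sin0.
Qed.

Lemma cos_natr2pi n : cos (n%:R * (2 * pi)) = 1 :> R.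
Proof.
by rewrite !mulr_natl -[_ *+ n]add0r (periodicn (@cosD2pi R)) cos0.
Qed.

Lemma circle_avg_cos (j k : nat) : j != k ->
  circle_avg (fun t => cos ((j%:R - k%:R) * t)) = 0 :> R.
Proof.
move=> jk; set d := j%:R - k%:R : R.
have d0 : d != 0 by rewrite subr_eq0 eqr_nat.
apply: (@circle_avg_derivative (fun t => d^-1 * sin (d * t))).
- move=> t; apply: continuous_comp; [exact: mulrl_continuous|].
  exact: continuous_cos.
- move=> t; apply: is_derive_eq.
  by rewrite /= /GRing.scale /= mulr1; field.
- rewrite mulr0 sin0 mulrBl sinB.
  by rewrite !sin_natr2pi mul0r mulr0 subr0.
Qed.

Lemma circle_avg_sin (j k : nat) :
  circle_avg (fun t => sin ((j%:R - k%:R) * t)) = 0 :> R.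
Proof.
have [->|jk] := eqVneq j k.
  under eq_fun do rewrite subrr mul0r sin0.
  by rewrite circle_avg_cst.
set d := j%:R - k%:R : R.
have d0 : d != 0 by rewrite subr_eq0 eqr_nat.
apply: (@circle_avg_derivative (fun t => - d^-1 * cos (d * t))).
- move=> t; apply: continuous_comp; [exact: mulrl_continuous|].
  exact: continuous_sin.
- move=> t; apply: is_derive_eq.
  by rewrite /= /GRing.scale /= mulr1; field.
- rewrite mulr0 mulrBl cosB.
  by rewrite !sin_natr2pi !cos_natr2pi cos0 mul0r mulr1 addr0.
Qed.

End bounded_measurable.

(** * Complex numbers and trigonometric polynomials *)

Section complex_basics.
Variable R : realType.
Implicit Types (z w : R[i]) (s t x : R).

Lemma ReD z w : Re (z + w) = Re z + Re w. Proof. by case: z w => ? ? []. Qed.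
Lemma ImD z w : Im (z + w) = Im z + Im w. Proof. by case: z w => ? ? []. Qed.
Lemma ReB z w : Re (z - w) = Re z - Re w. Proof. by case: z w => ? ? []. Qed.
Lemma ImB z w : Im (z - w) = Im z - Im w. Proof. by case: z w => ? ? []. Qed.
Lemma ReM z w : Re (z * w) = Re z * Re w - Im z * Im w.
Proof. by case: z w => ? ? []. Qed.
Lemma ImM z w : Im (z * w) = Re z * Im w + Im z * Re w.
Proof. by case: z w => ? ? []. Qed.
Lemma ReJ z : Re (conjc z) = Re z. Proof. by case: z. Qed.
Lemma ImJ z : Im (conjc z) = - Im z. Proof. by case: z. Qed.
Lemma conjcM z w : conjc (z * w) = conjc z * conjc w.
Proof.
apply/eqP; rewrite eq_complex !(ReJ, ImJ, ReM, ImM).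
by rewrite mulrNN mulrN mulNr opprD !eqxx.
Qed.
Lemma conjcD z w : conjc (z + w) = conjc z + conjc w.
Proof.
by apply/eqP; rewrite eq_complex !(ReJ, ImJ, ReD, ImD) opprD !eqxx.
Qed.
Lemma conjc_sum (I : Type) (r : seq I) (P : pred I) (F : I -> R[i]) :
  conjc (\sum_(i <- r | P i) F i) = \sum_(i <- r | P i) conjc (F i).
Proof. by apply: (big_morph _ conjcD); rewrite conjc0. Qed.
Lemma ReZ x z : Re (x%:C * z) = x * Re z.
Proof. by rewrite ReM /= mul0r subr0. Qed.

Lemma Re_sum (I : Type) (r : seq I) (P : pred I) (F : I -> R[i]) :
  Re (\sum_(i <- r | P i) F i) = \sum_(i <- r | P i) Re (F i).
Proof. by apply: (big_morph _ ReD). Qed.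

Lemma normc_ge0 z : 0 <= normc z.
Proof. by case: z => a b; exact: sqrtr_ge0. Qed.

Lemma normc_sqr z : normc z ^+ 2 = Re z ^+ 2 + Im z ^+ 2.
Proof. by case: z => a b; rewrite sqr_sqrtr// addr_ge0 ?sqr_ge0. Qed.

Lemma ReMJ z : Re (z * conjc z) = normc z ^+ 2.
Proof. by rewrite normc_sqr ReM ReJ ImJ; ring. Qed.

Lemma normcJ z : normc (conjc z) = normc z.
Proof. by case: z => a b; rewrite /= sqrrN. Qed.

Lemma normc_real x : normc x%:C = `|x|.
Proof. by rewrite /= expr0n addr0 sqrtr_sqr. Qed.

Lemma normr_Re_le z : `|Re z| <= normc z.
Proof.
rewrite -[leLHS]sqrtr_sqr; case: z => a b; rewrite ler_wsqrtr//=.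
by rewrite lerDl sqr_ge0.
Qed.

Lemma normr_Im_le z : `|Im z| <= normc z.
Proof.
rewrite -[leLHS]sqrtr_sqr; case: z => a b; rewrite ler_wsqrtr//=.
by rewrite lerDr sqr_ge0.
Qed.

Lemma Re_le_normc z : Re z <= normc z.
Proof. exact: le_trans (ler_norm _) (normr_Re_le z). Qed.

Lemma normcX z n : normc (z ^+ n) = normc z ^+ n.
Proof.
elim: n => [|n IH]; first by rewrite !expr0 Normc.normc1.
by rewrite !exprS Normc.normcM IH.
Qed.

Lemma normc_distC z w : normc (z - w) = normc (w - z).
Proof. by rewrite -normcN opprB. Qed.

Lemma le_normc_sum (I : Type) (r : seq I) (P : pred I) (F : I -> R[i]) :
  normc (\sum_(i <- r | P i) F i) <= \sum_(i <- r | P i) normc (F i).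
Proof.
elim/big_rec2: _ => [|i y z _ IH]; first by rewrite Normc.normc0.
exact: le_trans (le_normcD _ _) (lerD _ _).
Qed.

Definition cis t : R[i] := cos t +i* sin t.

Lemma cisD s t : cis (s + t) = cis s * cis t.
Proof.
apply/eqP; rewrite eq_complex /= cosD sinD; apply/andP; split => //.
by rewrite addrC.
Qed.

Lemma cisX n t : cis t ^+ n = cis (n%:R * t).
Proof.
elim: n => [|n IH]; first by rewrite expr0 mul0r /cis cos0 sin0.
by rewrite exprS IH -cisD -[n.+1%:R]nat1r mulrDl mul1r.
Qed.

Lemma cisJ t : conjc (cis t) = cis (- t).
Proof. by rewrite /cis cosN sinN. Qed.

Lemma normc_cis t : normc (cis t) = 1.
Proof. by rewrite /= cos2Dsin2 sqrtr1. Qed.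

Lemma circle_pointE r t : circle_point r t = r%:C * cis t.
Proof.
apply/eqP; rewrite eq_complex /= !mul0r subr0 addr0.
by rewrite !eqxx.
Qed.

Lemma normc_circle_point r t : 0 <= r -> normc (circle_point r t) = r.
Proof.
by move=> r0; rewrite circle_pointE Normc.normcM normc_cis mulr1 normc_real
  ger0_norm.
Qed.

Lemma circle_pointX r t n :
  circle_point r t ^+ n = (r ^+ n)%:C * cis (n%:R * t).
Proof. by rewrite circle_pointE exprMn cisX rmorphXn. Qed.

Lemma complex_normE z : `|z| = (normc z)%:C. Proof. by []. Qed.

End complex_basics.

Section complex_measurable.
Variable R : realType.
Implicit Types (F G : R -> R[i]).

Definition cbounded_measurable F : Prop :=
  bounded_measurable (fun t => Re (F t)) /\
  bounded_measurable (fun t => Im (F t)).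

Lemma cbounded_measurable_cst z : cbounded_measurable (fun=> z).
Proof. by split; exact: bounded_measurable_cst. Qed.

Lemma cbounded_measurableD F G : cbounded_measurable F ->
  cbounded_measurable G -> cbounded_measurable (fun t => F t + G t).
Proof.
move=> [rF iF] [rG iG]; split.
  by under eq_fun do rewrite ReD; exact: bounded_measurableD.
by under eq_fun do rewrite ImD; exact: bounded_measurableD.
Qed.

Lemma cbounded_measurableM F G : cbounded_measurable F ->
  cbounded_measurable G -> cbounded_measurable (fun t => F t * G t).
Proof.
move=> [rF iF] [rG iG]; split.
  under eq_fun do rewrite ReM.
  by apply: bounded_measurableB; exact: bounded_measurableM.
under eq_fun do rewrite ImM.
by apply: bounded_measurableD; exact: bounded_measurableM.
Qed.

Lemma cbounded_measurableJ F : cbounded_measurable F ->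
  cbounded_measurable (fun t => conjc (F t)).
Proof.
move=> [rF iF]; split; first by under eq_fun do rewrite ReJ.
by under eq_fun do rewrite ImJ; exact: bounded_measurableN.
Qed.

Lemma cbounded_measurable_cis (c : R) :
  cbounded_measurable (fun t => cis (c * t)).
Proof.
by split; [exact: bounded_measurable_cos | exact: bounded_measurable_sin].
Qed.

Lemma bounded_measurable_normc F : cbounded_measurable F ->
  bounded_measurable (fun t => normc (F t)).
Proof.
move=> [rF iF].
have -> : (fun t => normc (F t)) =
    (fun t => (Re (F t) * Re (F t) + Im (F t) * Im (F t)) `^ 2^-1).
  apply/funext => t; rewrite powR12_sqrt ?addr_ge0 -?expr2 ?sqr_ge0//.
  by case: (F t).
apply: bounded_measurable_powR; rewrite ?invr_ge0//.
  by apply: bounded_measurableD; exact: bounded_measurableM.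
by move=> t; rewrite addr_ge0// -expr2 sqr_ge0.
Qed.

Definition trig_poly (K : nat) (c : nat -> R[i]) (t : R) : R[i] :=
  \sum_(k < K) c k * cis (k%:R * t).

Lemma cbounded_measurable_trig_poly K c :
  cbounded_measurable (trig_poly K c).
Proof.
rewrite /trig_poly; elim: K => [|K IH].
  under eq_fun do rewrite big_ord0; exact: cbounded_measurable_cst.
under eq_fun do rewrite big_ord_recr/=.
apply: cbounded_measurableD => //.
apply: cbounded_measurableM; first exact: cbounded_measurable_cst.
exact: cbounded_measurable_cis.
Qed.

Lemma normc_trig_poly_le K c t :
  normc (trig_poly K c t) <= \sum_(k < K) normc (c k).
Proof.
apply: le_trans (le_normc_sum _ _ _) _; apply: ler_sum => k _.
by rewrite Normc.normcM normc_cis mulr1.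
Qed.

Lemma trig_polyD K b c t :
  trig_poly K (fun k => b k + c k) t = trig_poly K b t + trig_poly K c t.
Proof. by rewrite -big_split; apply: eq_bigr => k _; rewrite mulrDl. Qed.

Lemma trig_poly_widen K M c t : (K <= M)%N ->
  (forall k, (K <= k)%N -> c k = 0) -> trig_poly M c t = trig_poly K c t.
Proof.
move=> KM c0; rewrite /trig_poly (big_ord_widen M (fun k => c k * cis (k%:R * t)) KM).
rewrite [RHS]big_mkcond; apply: eq_bigr => k _.
by case: ltnP => // Kk; rewrite c0// mul0r.
Qed.

(** Orthogonality of the characters: in the double sum only the diagonal terms
    survive the average. *)
Lemma circle_avg_pairing K b c :
  circle_avg (fun t => Re (trig_poly K b t * conjc (trig_poly K c t))) =
  \sum_(k < K) Re (b k * conjc (c k)).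
Proof.
have E t : Re (trig_poly K b t * conjc (trig_poly K c t)) =
    \sum_(j < K) \sum_(k < K)
      (Re (b j * conjc (c k)) * cos ((j%:R - k%:R) * t)
       - Im (b j * conjc (c k)) * sin ((j%:R - k%:R) * t)).
  rewrite /trig_poly conjc_sum mulr_suml Re_sum; apply: eq_bigr => j _.
  rewrite mulr_sumr Re_sum; apply: eq_bigr => k _.
  by rewrite conjcM mulrACA cisJ -cisD -mulNr -mulrDl [LHS]ReM.
under eq_fun do rewrite E.
have bm w (d : R) : bounded_measurable (fun t : R =>
    Re w * cos (d * t) - Im w * sin (d * t)).
  apply: bounded_measurableB; apply: bounded_measurableZ.
    exact: bounded_measurable_cos.
  exact: bounded_measurable_sin.
rewrite circle_avg_sum; last by move=> j; exact: bounded_measurable_sum.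
apply: eq_bigr => j _; rewrite circle_avg_sum; last by move=> k; exact: bm.
rewrite (bigD1 j)//= [X in _ + X]big1 ?addr0 => [|k kj].
- under eq_fun do rewrite subrr mul0r cos0 sin0 mulr1 mulr0 subr0.
  by rewrite circle_avg_cst.
- rewrite circle_avgB.
  + rewrite !circle_avgZ ?circle_avg_sin ?circle_avg_cos ?mulr0 ?subr0//.
    * by rewrite eq_sym.
    * exact: bounded_measurable_sin.
    * exact: bounded_measurable_cos.
  + exact/bounded_measurableZ/bounded_measurable_cos.
  + exact/bounded_measurableZ/bounded_measurable_sin.
Qed.

Lemma circle_avg_parseval K c :
  circle_avg (fun t => normc (trig_poly K c t) ^+ 2) =
  \sum_(k < K) normc (c k) ^+ 2.
Proof.
under eq_fun do rewrite -ReMJ.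
by rewrite circle_avg_pairing; apply: eq_bigr => k _; rewrite ReMJ.
Qed.

End complex_measurable.

(** * Power series on the disc *)

Section expansion.
Variables (R : realType) (f : CC R -> CC R) (a : nat -> CC R).
Hypothesis fa : has_expansion f a.

Lemma expansion_cvg (z : R[i]) : normc z < 1 -> forall e : R, 0 < e ->
  exists N, forall n, (N <= n)%N ->
    normc (f z - \sum_(k < n) a k * z ^+ k) < e.
Proof.
move=> z1 e e0.
have dz : @disc R z by have : `|z| < 1%:C :> R[i]; [rewrite complex_normE ltcR | exact].
have /cvgrPdist_lt /(_ e%:C) := fa dz.
rewrite ltcR => /(_ e0) [N _ HN]; exists N => n Nn.
have := HN n Nn; rewrite /= /series/= big_mkord complex_normE ltcR.
exact.
Qed.

(** The terms of a convergent series are bounded: they are differences of two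
    partial sums, which eventually stay within [1] of the limit. *)
Lemma expansion_coef_bounded (r : R) : 0 <= r -> r < 1 ->
  exists B, forall k, normc (a k) * r ^+ k <= B.
Proof.
move=> r0 r1; have nr : normc r%:C < 1 by rewrite normc_real ger0_norm.
have [N HN] := expansion_cvg nr ltr01.
exists (2 + \sum_(k < N) normc (a k) * r ^+ k) => k.
have [kN|Nk] := ltnP k N.
  rewrite (bigD1 (Ordinal kN))//= addrCA lerDl addr_ge0// sumr_ge0// => i _.
  by rewrite mulr_ge0 ?normc_ge0 ?exprn_ge0.
have -> : normc (a k) * r ^+ k =
    normc ((f r%:C - \sum_(j < k) a j * r%:C ^+ j) -
           (f r%:C - \sum_(j < k.+1) a j * r%:C ^+ j)).
  have tele (x y u : R[i]) : x - y - (x - (y + u)) = u by ring.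
  rewrite big_ord_recr/= tele.
  by rewrite Normc.normcM normcX normc_real ger0_norm.
apply: le_trans (le_normcD _ _) _; rewrite normcN.
have := HN k Nk; have := HN k.+1 (leqW Nk).
have : 0 <= \sum_(j < N) normc (a j) * r ^+ j.
  by rewrite sumr_ge0// => j _; rewrite mulr_ge0 ?normc_ge0 ?exprn_ge0.
lra.
Qed.

(** On a smaller closed disc the partial sums converge uniformly, by
    comparison with a geometric series. *)
Lemma expansion_unif (r : R) : 0 <= r -> r < 1 -> forall e : R, 0 < e ->
  exists N, forall n, (N <= n)%N -> forall z : R[i], normc z <= r ->
    normc (f z - \sum_(k < n) a k * z ^+ k) <= e.
Proof.
(* Any radius [s] strictly between [r] and [1] yields the ratio [r / s < 1]. *)
move=> r0 r1 e e0; pose s := (1 + r) / 2.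
have rs : r < s by rewrite /s; lra.
have s1 : s < 1 by rewrite /s; lra.
have s0 : 0 < s by lra.
have [B HB] := expansion_coef_bounded (ltW s0) s1.
pose th := r / s.
have th0 : 0 <= th by rewrite divr_ge0// ltW.
have th1 : th < 1 by rewrite ltr_pdivrMr// mul1r.
have B0 : 0 <= B.
  by apply: le_trans (HB 0%N); rewrite expr0 mulr1 normc_ge0.
have term k z : normc z <= r -> normc (a k * z ^+ k) <= B * th ^+ k.
  move=> zr; rewrite Normc.normcM normcX.
  apply: (@le_trans _ _ (normc (a k) * r ^+ k)).
    by rewrite ler_wpM2l ?normc_ge0// lerXn2r ?nnegrE ?normc_ge0.
  rewrite [r in X in X <= _](_ : r = s * th); last by rewrite /th mulrC divfK ?gt_eqF.
  by rewrite exprMn mulrA ler_wpM2r ?exprn_ge0.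
have tail n d z : normc z <= r ->
    normc (\sum_(k < n + d) a k * z ^+ k - \sum_(k < n) a k * z ^+ k) <=
    B * (th ^+ n - th ^+ (n + d)) / (1 - th).
  move=> zr; elim: d => [|d IH].
    by rewrite addn0 !subrr Normc.normc0 mulr0 mul0r.
  rewrite addnS big_ord_recr/= addrAC.
  apply: le_trans (le_normcD _ _) _.
  apply: le_trans (lerD IH (term _ _ zr)) _.
  rewrite exprS le_eqVlt; apply/orP; left; apply/eqP.
  by field; rewrite subr_eq0 gt_eqF.
have : (fun n => th ^+ n) @ \oo --> (0 : R).
  by apply: cvg_expr; rewrite ger0_norm.
pose d := e / 2 * (1 - th) / (B + 1).
have d0 : 0 < d by rewrite /d divr_gt0 ?mulr_gt0 ?subr_gt0//; lra.
move=> /cvgrPdist_lt /(_ d d0) [N _ HN].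
exists N => n Nn z zr.
have zr1 : normc z < 1 by apply: le_lt_trans r1.
have [M HM] := expansion_cvg zr1 (divr_gt0 e0 (ltr0n R 2)).
have := HM (n + M)%N (leq_addl _ _); have := tail n M z zr.
have : B * (th ^+ n - th ^+ (n + M)) / (1 - th) <= e / 2.
  rewrite ler_pdivrMr ?subr_gt0//.
  have := HN n Nn; rewrite /= sub0r normrN ger0_norm ?exprn_ge0// => /ltW.
  rewrite /d ler_pdivlMr; last by lra.
  have : 0 <= th ^+ n by exact: exprn_ge0.
  have : 0 <= B * th ^+ (n + M) by rewrite mulr_ge0 ?exprn_ge0.
  nra.
move=> h1 h2 h3.
rewrite -(subrK (\sum_(k < n + M) a k * z ^+ k) (f z)) -addrA.
by apply: le_trans (le_normcD _ _) _; lra.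
Qed.

Lemma partial_sum_circle (r t : R) n :
  \sum_(k < n) a k * circle_point r t ^+ k =
  trig_poly n (fun k => a k * (r ^+ k)%:C) t.
Proof. by apply: eq_bigr => k _; rewrite circle_pointX mulrA. Qed.

(** On a circle [f] is a uniform limit of trigonometric polynomials; measurability
    and boundedness pass to the limit. *)
Lemma cbounded_measurable_circle (r : R) : 0 <= r -> r < 1 ->
  cbounded_measurable (fun t => f (circle_point r t)).
Proof.
move=> r0 r1.
pose S n t := trig_poly n (fun k => a k * (r ^+ k)%:C) t : R[i].
have SE e : 0 < e -> exists N, forall n, (N <= n)%N -> forall t,
    normc (f (circle_point r t) - S n t) <= e.
  move=> e0; have [N HN] := expansion_unif r0 r1 e0.
  exists N => n Nn t; rewrite /S -partial_sum_circle; apply: HN => //.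
  by rewrite normc_circle_point.
have [N /(_ N (leqnn N)) HN] := SE 1 ltr01.
pose D := 1 + \sum_(k < N) normc (a k * (r ^+ k)%:C).
have fD t : normc (f (circle_point r t)) <= D.
  rewrite -(subrK (S N t) (f _)); apply: le_trans (le_normcD _ _) _.
  by apply: lerD (HN t) (normc_trig_poly_le _ _ _).
split; (split; last first).
- by exists D => t; apply: le_trans (fD t); exact: normr_Re_le.
- apply: (@measurable_fun_cvg _ _ _ setT (fun n t => Re (S n t))).
    by move=> n; have [[]] := cbounded_measurable_trig_poly n
      (fun k => a k * (r ^+ k)%:C).
  move=> t _; apply/cvgrPdist_le => e /SE [M HM].
  exists M => // n Mn /=; apply: le_trans (HM n Mn t).
  by rewrite -ReB normr_Re_le.
- by exists D => t; apply: le_trans (fD t); exact: normr_Im_le.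
- apply: (@measurable_fun_cvg _ _ _ setT (fun n t => Im (S n t))).
    by move=> n; have [_ []] := cbounded_measurable_trig_poly n
      (fun k => a k * (r ^+ k)%:C).
  move=> t _; apply/cvgrPdist_le => e /SE [M HM].
  exists M => // n Mn /=; apply: le_trans (HM n Mn t).
  by rewrite -ImB normr_Im_le.
Qed.

(** Fourier coefficients of [f] on the circle of radius [r]: replacing [f] by a
    partial sum changes the average by at most a uniform error, and for a partial
    sum the formula is orthogonality. *)
Lemma expansion_pairing (r : R) (K : nat) (c : nat -> R[i]) :
  0 <= r -> r < 1 -> (forall k, (K <= k)%N -> c k = 0) ->
  circle_avg (fun t => Re (f (circle_point r t) * conjc (trig_poly K c t))) =
  \sum_(k < K) r ^+ k * Re (a k * conjc (c k)).
Proof.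
move=> r0 r1 c0; apply/eqP; rewrite -subr_eq0 -normr_le0; apply/ler_addgt0Pl.
move=> e e0; rewrite addr0.
pose H := \sum_(k < K) normc (c k).
have H0 : 0 <= H by rewrite sumr_ge0// => k _; exact: normc_ge0.
have eH : 0 < e / (H + 1) by rewrite divr_gt0//; lra.
have [N HN] := expansion_unif r0 r1 eH.
pose M := maxn N K.
pose S t := trig_poly M (fun k => a k * (r ^+ k)%:C) t : R[i].
have SP : circle_avg (fun t => Re (S t * conjc (trig_poly K c t))) =
    \sum_(k < K) r ^+ k * Re (a k * conjc (c k)).
  transitivity (circle_avg (fun t => Re (S t * conjc (trig_poly M c t)))).
    congr circle_avg; apply/funext => t.
    by rewrite (trig_poly_widen _ (leq_maxr N K) c0).
  rewrite circle_avg_pairing.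
  rewrite (big_ord_widen M (fun k => r ^+ k * Re (a k * conjc (c k))) (leq_maxr N K)).
  rewrite [RHS]big_mkcond; apply: eq_bigr => k _.
  rewrite mulrAC [_ * (r ^+ k)%:C]mulrC ReZ.
  by case: ltnP => // Kk; rewrite c0// conjc0 mulr0 mulr0.
have bf := cbounded_measurable_circle r0 r1.
have bP := cbounded_measurableJ (cbounded_measurable_trig_poly K c).
have [bfP _] := cbounded_measurableM bf bP.
have [bSP _] := cbounded_measurableM
  (cbounded_measurable_trig_poly M (fun k => a k * (r ^+ k)%:C)) bP.
rewrite -SP -circle_avgB//.
have D t : `|Re (f (circle_point r t) * conjc (trig_poly K c t)) -
    Re (S t * conjc (trig_poly K c t))| <= e.
  rewrite -ReB -mulrBl; apply: le_trans (normr_Re_le _) _.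
  rewrite Normc.normcM normcJ.
  apply: (@le_trans _ _ (e / (H + 1) * H)).
    apply: ler_pM; rewrite ?normc_ge0//; last exact: normc_trig_poly_le.
    rewrite /S -partial_sum_circle; apply: HN; first exact: leq_maxl.
    by rewrite normc_circle_point.
  by rewrite mulrAC ler_pdivrMr ?ler_wpM2l ?(ltW e0)//; lra.
rewrite ler_norml -[X in _ <= _ <= X](circle_avg_cst e).
rewrite -[X in X <= _ <= _](circle_avg_cst (- e)).
apply/andP; split; apply: le_circle_avg; do ?[exact: bounded_measurable_cst |
  exact: bounded_measurableB] => t _; have := D t; rewrite ler_norml => /andP[] //.
Qed.

End expansion.

(** The pairing formula expresses [Re ((a n - b n) * conj (a n - b n)) * r ^ n] as a
    difference of two equal averages of [f]. *)
Lemma expansion_unique (R : realType) (f : CC R -> CC R) (a b : nat -> CC R) :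
  has_expansion f a -> has_expansion f b -> a = b.
Proof.
move=> fa fb; apply/funext => n.
pose c k := if k == n then a n - b n else 0 : R[i].
have c0 k : (n.+1 <= k)%N -> c k = 0 by rewrite /c => /gtn_eqF ->.
have h0 : 0 <= 2^-1 :> R by lra.
have h1 : 2^-1 < 1 :> R by lra.
have := expansion_pairing fa h0 h1 c0.
rewrite (expansion_pairing fb h0 h1 c0) !big_ord_recr/= !big1 => [|i _|i _]; last 2 first.
- by rewrite /c ltn_eqF// conjc0 !mulr0.
- by rewrite /c ltn_eqF// conjc0 !mulr0.
rewrite !add0r /c eqxx => /mulfI e.
have : Re ((a n - b n) * conjc (a n - b n)) = 0.
  by rewrite mulrBl ReB e ?subrr// expf_neq0// invr_eq0.
rewrite ReMJ => /eqP; rewrite expf_eq0/= => /eqP/Normc.eq0_normc/eqP.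
by rewrite subr_eq0 => /eqP.
Qed.

(** * Iterates of the weighted shift *)

Section taylor_shift.
Variables (R : realType) (alpha : R).
Implicit Types (f g : CC R -> CC R) (a b : nat -> CC R).

Definition shift_coef a (k : nat) : CC R := a k.+1 * (weight alpha k.+1)%:C.

Lemma expansion_at0 f a : has_expansion f a -> f 0 = a 0%N.
Proof.
move=> fa; apply/eqP; rewrite -subr_eq0; apply/eqP/Normc.eq0_normc/eqP.
rewrite eq_le normc_ge0 andbT.
apply/ler_addgt0Pl => e e0; rewrite addr0.
have n0 : normc (0 : R[i]) < 1 by rewrite Normc.normc0 ltr01.
have [N /(_ N.+1 (leqW (leqnn N)))] := expansion_cvg fa n0 e0.
rewrite big_ord_recl/= big1 ?addr0 ?expr0 ?mulr1 => [/ltW //|i _].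
by rewrite expr0n mulr0.
Qed.

Lemma has_expansion0 : has_expansion (fun=> 0 : CC R) (fun=> 0).
Proof.
move=> z _; apply: cvg_near_cst; apply: nearW => n.
by rewrite /series/= big1// => k _; rewrite mul0r.
Qed.

(** The alternative covers the default value chosen when the shifted series is not
    the expansion of any function.  Along the orbit of a hypercyclic function it
    is excluded later, since the orbit would then vanish. *)
Lemma taylor_shiftP f a : has_expansion f a ->
  has_expansion (taylor_shift alpha f) (shift_coef a) \/
  taylor_shift alpha f = (fun=> 0).
Proof.
move=> fa; rewrite /taylor_shift; case: xgetP => [g _ [b fb gb]|_]; last by right.
by left; rewrite (expansion_unique fa fb).
Qed.

Lemma taylor_shift0 f : has_expansion f (fun=> 0) ->
  has_expansion (taylor_shift alpha f) (fun=> 0).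
Proof.
move=> /taylor_shiftP[|->]; last exact: has_expansion0.
rewrite (_ : shift_coef _ = fun=> 0)//.
by apply/funext => k; rewrite /shift_coef mul0r.
Qed.

Lemma powR_weight (k : nat) :
  k.+1%:R `^ alpha * weight alpha k.+1 = k.+2%:R `^ alpha.
Proof.
rewrite /weight -powRM ?addr_ge0 ?invr_ge0//; congr (_ `^ _).
by rewrite mulrDr mulr1 divff ?pnatr_eq0// natr1.
Qed.

(** The normalised coefficients [b k * (k + 1) ^ alpha] are merely translated
    by the weighted shift, which evaluates the iterates at the origin.  In the
    second alternative some iterate took the default value, and the orbit
    vanishes on the disc from then on. *)
Lemma taylor_shift_iter f a : has_expansion f a ->
  (forall n, iter n (taylor_shift alpha) f 0 = a n * (n.+1%:R `^ alpha)%:C) \/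
  exists n0, forall m, (n0 < m)%N -> iter m (taylor_shift alpha) f 0 = 0.
Proof.
move=> fa; pose T := taylor_shift alpha.
have [[n0 Tn0]|H] := pselect (exists n, iter n.+1 T f = fun=> 0).
  right; exists n0 => m n0m.
  suff /expansion_at0 -> : has_expansion (iter m T f) (fun=> 0) by [].
  rewrite -(subnK n0m); elim: (m - n0.+1)%N => [|d IH].
    rewrite add0n Tn0; exact: has_expansion0.
  by rewrite addSn iterS; exact: taylor_shift0.
left => n; suff : exists2 b, has_expansion (iter n T f) b & forall k,
    b k * (k.+1%:R `^ alpha)%:C = a (n + k)%N * ((n + k).+1%:R `^ alpha)%:C.
  move=> [b /expansion_at0 -> /(_ 0%N)].
  by rewrite addn0 powR1 mulr1.
elim: n => [|n [b gb bE]]; first by exists a.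
have [gT|gT] := taylor_shiftP gb; last by exfalso; apply: H; exists n.
exists (shift_coef b) => // k.
by rewrite /shift_coef -mulrA -rmorphM/= mulrC mulrC [weight _ _ * _]mulrC powR_weight
  bE addnS addSn.
Qed.

End taylor_shift.

(** * Sets of positive upper density *)

Section density.
Variables (R : realType) (gamma : R).
Implicit Type E : set nat.

Definition beta_weight (k : nat) : R := expR (k%:R `^ gamma).

(** Positivity of the upper density without division: along a sequence of [N], the
    set keeps a fixed proportion [d] of the weight of [[1, N]]. *)
Definition beta_dense E : Prop := exists2 d : R, 0 < d & forall M : nat,
  exists2 N, (M <= N)%N &
    d * (\sum_(1 <= k < N.+1) beta_weight k) <=
    \sum_(1 <= k < N.+1 | k \in E) beta_weight k.

Lemma beta_weight_gt0 k : 0 < beta_weight k. Proof. exact: expR_gt0. Qed.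

Lemma beta_weight_ge1 k : 1 <= beta_weight k.
Proof. by rewrite -(expR0 R) ler_expR powR_ge0. Qed.

Lemma upper_beta_density_gt0 E : (0 < upper_beta_density gamma E)%E ->
  beta_dense E.
Proof.
rewrite /upper_beta_density /limn_esup /limf_esup => d0.
have [d dgt0 dlt] : exists2 d : R, 0 < d & (d%:E < ereal_inf
    [set ereal_sup ((fun n =>
      ((\sum_(1 <= k < n.+1 | k \in E) beta_weight k) /
       (\sum_(1 <= k < n.+1) beta_weight k))%:E) @` V) | V in \oo])%E.
  move: d0; rewrite /beta_weight; case: ereal_inf => [r| |//].
    by rewrite lte_fin => r0; exists (r / 2); rewrite ?lte_fin; lra.
  by move=> _; exists 1; rewrite ?ltr01 ?ltry.
exists d => // M.
have /ereal_sup_gt [_ [N /= MN <-]] : (d%:E < ereal_sup ((fun n =>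
      ((\sum_(1 <= k < n.+1 | k \in E) beta_weight k) /
       (\sum_(1 <= k < n.+1) beta_weight k))%:E) @` [set n | (M.+1 <= n)%N]))%E.
  apply: lt_le_trans dlt _; apply: ereal_inf_lbound.
  by exists [set n | (M.+1 <= n)%N] => //; exists M.+1.
rewrite lte_fin ltr_pdivlMr => [/ltW h|]; first by exists N => //; exact: ltnW.
rewrite big_nat_recr/=; last by case: N MN.
rewrite ltr_wpDl ?beta_weight_gt0// sumr_ge0// => k _.
exact/ltW/beta_weight_gt0.
Qed.

Lemma beta_denseS E F : E `<=` F -> beta_dense E -> beta_dense F.
Proof.
move=> EF [d d0 H]; exists d => // M; have [N MN HN] := H M; exists N => //.
apply: le_trans HN _; rewrite big_mkcond [leRHS]big_mkcond/=.
apply: ler_sum => k _; case: ifPn => kE; last first.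
  by case: ifP => // _; exact/ltW/beta_weight_gt0.
by rewrite ifT// inE; apply: EF; rewrite inE in kE.
Qed.

(** Every weight is at least [1], so the total weight diverges and a bounded set
    has density zero. *)
Lemma beta_dense_unbounded E n0 : (forall n, E n -> (n <= n0)%N) ->
  ~ beta_dense E.
Proof.
move=> En0 [d d0 H].
pose S := \sum_(1 <= k < n0.+1) beta_weight k.
have S0 : 0 <= S by rewrite sumr_ge0// => k _; exact/ltW/beta_weight_gt0.
have [N] := H (maxn n0 (Num.bound (S / d))); rewrite geq_max => /andP[n0N SN].
apply/negP; rewrite -ltNge.
apply: (@le_lt_trans _ _ S).
  rewrite /S (big_nat_widen 1 n0.+1 N.+1) ?ltnS// big_mkcond [leRHS]big_mkcond/=.
  apply: ler_sum => k _; case: ifPn => kE; last first.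
    by case: ifP => // _; exact/ltW/beta_weight_gt0.
  by rewrite ifT// ltnS; apply: En0; rewrite inE in kE.
rewrite mulrC -ltr_pdivrMr//.
apply: (@lt_le_trans _ _ N%:R).
  have Sd : 0 <= S / d by rewrite divr_ge0// ltW.
  by apply: lt_le_trans (archi_boundP Sd) _; rewrite ler_nat.
have -> : N%:R = \sum_(1 <= k < N.+1) (1 : R).
  by rewrite sumr_const_nat subSS subn0.
by apply: ler_sum => k _; exact: beta_weight_ge1.
Qed.

End density.

(** * Large coefficients of a hypercyclic function *)

Section hypercyclic.
Variables (R : realType).

(** Evaluation at the origin is continuous because a singleton is compact. *)
Lemma open_eval0 : open ([set g | normc (g 0 - 2) < 1] :
  set (cvg_on_compacts R)).
Proof.
rewrite openE => g /= g2.
have : {family compactly_in (@disc R), nbhs (g : cvg_on_compacts R) --> g}.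
  by rewrite fam_cvgE.
move=> /fam_cvgP /(_ [set 0]).
have : compactly_in (@disc R) [set 0].
  split; last exact: compact_set1.
  by move=> _ ->; rewrite /disc /= normr0 ltr01.
move=> c0 /(_ c0).
rewrite uniform_set1 => /cvgrPdist_lt.
have e0 : 0 < (1 - normc (g 0 - 2))%:C :> R[i] by rewrite ltcR subr_gt0.
move=> /(_ _ e0); apply: filterS => h /=.
rewrite complex_normE ltcR normc_distC => hg.
rewrite -(subrK (g 0) (h 0)) -addrA.
by apply: le_lt_trans (le_normcD _ _) _; rewrite -ltrBrDr.
Qed.

(** Visits to the open set around the constant [2] make [|T ^ n f (0)| >= 1].  If
    [f] had no expansion, or if the orbit reached the default value, the orbit
    would vanish at the origin from some time on, and the set of visits would be
    bounded. *)
Lemma hypercyclic_coef (alpha gamma : R) (f : CC R -> CC R) :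
  U_beta_frequently_hypercyclic gamma (taylor_shift alpha) f ->
  exists2 a, has_expansion f a &
    beta_dense gamma [set n | 1 <= n.+1%:R `^ alpha * normc (a n)].
Proof.
move=> [_ /(_ _ open_eval0) hc].
have /hc : @HD R `&` [set g | normc (g 0 - 2) < 1] !=set0.
  exists (fun=> 2); split; last first.
    have n0 : normc (2 - 2 : R[i]) = 0 by rewrite subrr Normc.normc0.
    by rewrite /mkset n0 ltr01.
  by move=> z _; exact: derivable_cst.
move=> /upper_beta_density_gt0 d.
pose T := taylor_shift alpha.
have n2 : ~ normc (0 - 2 : R[i]) < 1.
  rewrite sub0r normcN normcMn Normc.normc1; lra.
have [[a fa]|Nf] := pselect (exists a, has_expansion f a).
  exists a => //.
  have [Ta|[n0 Ta]] := taylor_shift_iter alpha fa.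
    apply: beta_denseS d => n /= [_].
    rewrite Ta => h.
    have : normc (2 : R[i]) = 2.
      by rewrite normcMn Normc.normc1.
    have := le_normcD (a n * (n.+1%:R `^ alpha)%:C)
      (2 - a n * (n.+1%:R `^ alpha)%:C).
    rewrite addrC subrK normc_distC Normc.normcM normc_real.
    by rewrite (ger0_norm (powR_ge0 _ _)) mulrC; lra.
  exfalso; apply: (beta_dense_unbounded (n0 := n0)) d => n /= [_].
  by rewrite leqNgt; apply: contraPN => /Ta ->.
exfalso; apply: (beta_dense_unbounded (n0 := 0)) d => -[//|n] /= [_].
have Tf0 : T f = fun=> 0.
  rewrite /T /taylor_shift; case: xgetP => // g _ [a fa _].
  by exfalso; apply: Nf; exists a.
have : has_expansion (iter n.+1 T f) (fun=> 0).
  elim: n => [|n IH]; first by rewrite /= Tf0; exact: has_expansion0.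
  by rewrite iterS; exact: taylor_shift0.
by rewrite -iterS -/T => /expansion_at0 ->.
Qed.

End hypercyclic.

Section dense_block.
Variables (R : realType) (gamma : R).
Hypotheses (gamma_gt0 : 0 < gamma) (gamma_lt1 : gamma < 1).
Implicit Type E : set nat.

Lemma powR_natD1 (N : nat) (x : R) : (0 < N)%N ->
  N%:R `^ x * N%:R `^ (1 - x) = N%:R :> R.
Proof.
move=> N0; rewrite -powRD; last by rewrite pnatr_eq0 -lt0n N0 implybT.
by rewrite addrCA subrr addr0 powRr1.
Qed.

Lemma powR_nat_large (x X : R) : 0 < x -> exists N0 : nat, forall N : nat,
  (N0 <= N)%N -> X <= N%:R `^ x.
Proof.
move=> x0; exists (Num.bound (`|X| `^ x^-1)) => N NX.
apply: le_trans (ler_norm X) _.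
have -> : `|X| = (`|X| `^ x^-1) `^ x.
  by rewrite -powRrM mulVf ?powRr1// gt_eqF.
apply: ge0_ler_powR; rewrite ?nnegrE ?powR_ge0 ?ler0n ?(ltW x0)//.
apply/ltW; apply: lt_le_trans (archi_boundP (powR_ge0 _ _)) _.
by rewrite ler_nat.
Qed.

(** As [(k / N) ^ gamma >= k / N], the exponent satisfies
    [k ^ gamma >= N ^ gamma - (N - k) / N ^ (1 - gamma)], so it loses at most [1]
    over a stretch of length [N ^ (1 - gamma)]. *)
Lemma beta_weight_near (N k : nat) : (0 < N)%N -> (k <= N)%N ->
  N%:R - N%:R `^ (1 - gamma) <= k%:R ->
  expR (-1) * beta_weight gamma N <= beta_weight gamma k.
Proof.
move=> N0 kN kL; rewrite /beta_weight -expRD ler_expR.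
have N0' : 0 < N%:R :> R by rewrite ltr0n.
move: kL kN; have [->|k0] := posnP k => kL kN.
  have : N%:R `^ gamma <= 1 :> R.
    rewrite -(ler_pM2r (powR_gt0 (1 - gamma) N0')) powR_natD1// mul1r.
    by move: kL; rewrite subr_le0.
  by move: (powR_ge0 (0%:R : R) gamma); lra.
have -> : k%:R = N%:R * (k%:R / N%:R) :> R by rewrite mulrC divfK ?gt_eqF.
rewrite powRM ?divr_ge0//.
have h : k%:R / N%:R <= (k%:R / N%:R) `^ gamma :> R.
  apply: ger1_powR; last exact: ltW.
  by rewrite divr_gt0 ?ltr0n//= ler_pdivrMr// mul1r ler_nat.
apply: le_trans (ler_wpM2l (powR_ge0 _ _) h).
have -> : N%:R `^ gamma * (k%:R / N%:R) = k%:R / N%:R `^ (1 - gamma) :> R.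
  rewrite -[X in _ * (_ / X)](powR_natD1 gamma N0).
  by field; rewrite !gt_eqF ?powR_gt0.
rewrite ler_pdivlMr ?powR_gt0// mulrDl powR_natD1//; lra.
Qed.

(** Only the last [l + 1 > N ^ (1 - gamma)] terms are kept, each of which is
    comparable to the largest one. *)
Lemma beta_weight_sum_ge (N : nat) : (1 < N)%N ->
  N%:R `^ (1 - gamma) * (expR (-1) * beta_weight gamma N) <=
  \sum_(1 <= k < N.+1) beta_weight gamma k.
Proof.
move=> N1; set L := _ `^ _; pose l := Num.truncn L.
have L0 : 0 <= L by exact: powR_ge0.
have N0 : (0 < N)%N by exact: ltnW.
have LN : L < N%:R.
  rewrite -[ltRHS](powR_natD1 gamma N0) -[ltLHS]mul1r ltr_pM2r ?powR_gt0 ?ltr0n//.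
  rewrite -[ltLHS](powRr0 N%:R) /powR pnatr_eq0 gtn_eqF// mul0r ltr_expR.
  by rewrite mulr_gt0// ln_gt0// ltr1n.
have /andP[lL Ll] := truncn_itv L0.
have lN : (l < N)%N by rewrite -(ltr_nat R); apply: le_lt_trans LN.
rewrite (@big_cat_nat _ _ _ (N - l)%N)/= ?subn_gt0//; last first.
  by rewrite leqW// leq_subr.
rewrite ler_wpDl//.
  by rewrite sumr_ge0// => k _; exact/ltW/beta_weight_gt0.
apply: (@le_trans _ _ (\sum_(N - l <= k < N.+1)
  (expR (-1) * beta_weight gamma N))).
  rewrite sumr_const_nat subSn ?leq_subr// subKn ?(ltnW lN)//.
  rewrite -[leRHS]mulr_natl ler_wpM2r ?mulr_ge0 ?expR_ge0 ?(ltW (beta_weight_gt0 _ _))//.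
  exact: ltW.
apply: ler_sum_nat => k; rewrite ltnS => /andP[lk kN]; apply: beta_weight_near => //.
apply: (@le_trans _ _ (N - l)%:R); last by rewrite ler_nat.
by rewrite natrB ?(ltnW lN)// lerD2l lerN2.
Qed.

(** For [k <= N / 2] the exponent drops from [x = N ^ gamma] to at most
    [(1 - kap) x], and the gain [exp (kap x) >= (kap x / 2) ^ 2] beats the factor
    [x], which is the number [N] of terms divided by [N ^ (1 - gamma)]. *)
Lemma beta_weight_half (eta : R) : 0 < eta -> exists N0 : nat,
  forall N k : nat, (N0 <= N)%N -> (k.*2 <= N)%N ->
    N%:R `^ gamma * beta_weight gamma k <= eta * beta_weight gamma N.
Proof.
move=> eta0; pose kap : R := 1 - 2^-1 `^ gamma.
have half : (2^-1 : R) `^ gamma < 1.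
  rewrite /powR invr_eq0 pnatr_eq0/= -[ltRHS]expR0 ltr_expR.
  by rewrite pmulr_rlt0// ln_lt0//; apply/andP; split; lra.
have kap0 : 0 < kap by rewrite subr_gt0.
have [N0 HN0] := powR_nat_large (4 / (eta * kap ^+ 2)) gamma_gt0.
exists N0.+1 => N k NN0 kN.
have {HN0} := HN0 N (ltnW NN0).
set x := N%:R `^ gamma => hx.
have x0 : 0 <= x by exact: powR_ge0.
have kx : k%:R `^ gamma <= (1 - kap) * x.
  rewrite /kap opprB addrC subrK /x -powRM ?invr_ge0 ?ler0n//.
  apply: ge0_ler_powR; rewrite ?nnegrE ?mulr_ge0 ?invr_ge0 ?ler0n ?(ltW gamma_gt0)//.
  by rewrite mulrC ler_pdivlMr// -natrM ler_nat muln2.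
rewrite /beta_weight -/x.
apply: (@le_trans _ _ (x * expR ((1 - kap) * x))).
  by rewrite ler_wpM2l// ler_expR.
have -> : expR x =
    expR ((1 - kap) * x) * (expR (kap * x / 2) * expR (kap * x / 2)).
  by rewrite -!expRD; congr expR; field.
rewrite mulrC [leRHS]mulrCA ler_wpM2l ?expR_ge0//.
have h : kap * x / 2 <= expR (kap * x / 2).
  by apply: le_trans (expR_ge1Dx _); rewrite lerDr.
have h0 : 0 <= kap * x / 2 by rewrite divr_ge0// mulr_ge0// ltW.
apply: (@le_trans _ _ (eta * ((kap * x / 2) * (kap * x / 2)))).
  move: hx; rewrite ler_pdivrMr ?mulr_gt0 ?exprn_gt0// => hx.
  nra.
by rewrite ler_wpM2l ?(ltW eta0)// ler_pM.
Qed.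

(** The indices of [E] below [N / 2] have negligible weight, and each of the others
    weighs at most [exp (N ^ gamma)]; as their total weight is a fixed proportion
    of at least [N ^ (1 - gamma) exp (N ^ gamma) / e], there are many of them. *)
Lemma beta_dense_block E : beta_dense gamma E ->
  exists2 c : R, 0 < c & forall M : nat, exists2 N : nat, (M <= N)%N &
    c * N%:R `^ (1 - gamma) <=
    \sum_(k < N.+1 | (N < k.*2)%N && (val k \in E)) 1.
Proof.
move=> [d d0 H]; pose c := d * expR (-1) / 2.
have c0 : 0 < c by rewrite divr_gt0// mulr_gt0// expR_gt0.
have [N0 HN0] := beta_weight_half c0.
exists c => // M; have [N] := H (maxn (maxn N0 M) 2).
rewrite !geq_max -andbA => /and3P[N0N MN N2] dS; exists N => //.
have Np : (0 < N)%N by exact: ltnW.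
set W := beta_weight gamma N.
have W0 : 0 < W by exact: beta_weight_gt0.
set L := N%:R `^ (1 - gamma); set m := \sum_(_ < _ | _) _.
have L0 : 0 < L by rewrite powR_gt0// ltr0n.
(* The small indices are charged [c * W / N ^ gamma] each, hence [c * L * W] in
   total; this is half of the lower bound, by the choice of [c]. *)
have up : \sum_(1 <= k < N.+1 | k \in E) beta_weight gamma k <=
    c * L * W + m * W.
  have -> : c * L * W = \sum_(k < N) (c * W / N%:R `^ gamma).
    rewrite sumr_const card_ord -[RHS]mulr_natr.
    have A0 : 0 < N%:R `^ gamma :> R by rewrite powR_gt0// ltr0n.
    have : N%:R = N%:R `^ gamma * L by rewrite powR_natD1.
    move: A0; set A := N%:R `^ gamma => A0 ->.
    by field; rewrite gt_eqF.
  rewrite big_add1/= big_mkord.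
  have -> : m = \sum_(k < N | (N < k.+1.*2)%N && (k.+1 \in E)) 1.
    by rewrite /m big_mkcond big_ord_recl/= add0r [RHS]big_mkcond.
  rewrite mulr_suml big_mkcond [X in _ <= _ + X]big_mkcond -big_split/=.
  apply: ler_sum => k _.
  have e0 : 0 <= c * W / N%:R `^ gamma.
    by rewrite divr_ge0 ?powR_ge0// mulr_ge0 ?ltW.
  case: ifPn => kE; last by rewrite andbF addr0.
  rewrite andbT; case: ltnP => kN.
    rewrite mul1r ler_wpDl// /W /beta_weight ler_expR.
    by apply: ge0_ler_powR; rewrite ?nnegrE ?ler0n ?ler_nat// ltW.
  rewrite addr0 ler_pdivlMr ?powR_gt0 ?ltr0n// mulrC.
  exact: HN0.
have := le_trans (ler_wpM2l (ltW d0) (beta_weight_sum_ge N2)) (le_trans dS up).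
rewrite -/W -/L.
have -> : d * (L * (expR (-1) * W)) = c * L * W + c * L * W by rewrite /c; field.
by rewrite lerD2l ler_pM2r.
Qed.

End dense_block.

(** * Lower bounds for integral means by duality *)

Section duality.
Variables (R : realType) (P Q : R).
Hypotheses (P_ge1 : 1 <= P) (Q_ge2 : 2 <= Q) (PQ : P^-1 + Q^-1 = 1).

Let P_gt0 : 0 < P. Proof. exact: lt_le_trans P_ge1. Qed.
Let Q_gt0 : 0 < Q. Proof. by apply: lt_le_trans Q_ge2. Qed.

Lemma bounded_measurable_normc_powR (F : R -> R[i]) (x : R) : 0 <= x ->
  cbounded_measurable F -> bounded_measurable (fun t => normc (F t) `^ x).
Proof.
move=> x0 bF; apply: bounded_measurable_powR => //.
  exact: bounded_measurable_normc.
by move=> t; exact: normc_ge0.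
Qed.

(** The parameter [lam] leaves the scale of the test polynomial free, which makes
    the inequality of Young as strong as that of Hoelder. *)
Lemma pairing_young (f : CC R -> CC R) (a : nat -> CC R) (r lam : R)
    (K : nat) (c : nat -> R[i]) :
  has_expansion f a -> 0 <= r -> r < 1 -> 0 <= lam ->
  (forall k, (K <= k)%N -> c k = 0) ->
  lam * (\sum_(k < K) r ^+ k * Re (a k * conjc (c k))) <=
  lam `^ P * circle_avg (fun t => normc (f (circle_point r t)) `^ P) +
  circle_avg (fun t => normc (trig_poly K c t) `^ Q).
Proof.
move=> fa r0 r1 lam0 c0.
have bf := cbounded_measurable_circle fa r0 r1.
have bP := cbounded_measurable_trig_poly K c.
have [bfP _] := cbounded_measurableM bf (cbounded_measurableJ bP).
have bfp := bounded_measurable_normc_powR (ltW P_gt0) bf.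
have bPq := bounded_measurable_normc_powR (ltW Q_gt0) bP.
rewrite -(expansion_pairing fa r0 r1 c0) -!circle_avgZ//.
rewrite -circle_avgD//; last exact: bounded_measurableZ.
apply: le_circle_avg; first exact: bounded_measurableZ.
  by apply: bounded_measurableD => //; exact: bounded_measurableZ.
move=> t _; set z := f _; set w := trig_poly _ _ _.
apply: (@le_trans _ _ ((lam * normc z) * normc w)).
  rewrite -mulrA ler_wpM2l//; apply: le_trans (Re_le_normc _) _.
  by rewrite Normc.normcM normcJ.
have z0 : 0 <= lam * normc z by rewrite mulr_ge0 ?normc_ge0.
apply: le_trans (conjugate_powR z0 (normc_ge0 w) P_gt0 Q_gt0 PQ) _.
rewrite -powRM ?normc_ge0//.
apply: lerD; rewrite ler_pdivrMr// ler_peMr ?powR_ge0//.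
by apply: le_trans Q_ge2; rewrite ler1n.
Qed.

(** On the probability space of the circle, a bound on the mean of order [p]
    controls the mean of every smaller order [P]; splitting the values of
    [|f|] at the height [M] costs only the factor [2]. *)
Lemma circle_avg_le_integral_mean (f : CC R -> CC R) (a : nat -> CC R)
    (p : \bar R) (r M : R) :
  has_expansion f a -> 0 <= r -> r < 1 -> (P%:E <= p)%E -> 0 < M ->
  (integral_mean p f r <= M%:E)%E ->
  circle_avg (fun t => normc (f (circle_point r t)) `^ P) <= 2 * M `^ P.
Proof.
move=> fa r0 r1; have bf := cbounded_measurable_circle fa r0 r1.
have bfP := bounded_measurable_normc_powR (ltW P_gt0) bf.
case: p => [p| |//] /=.
- rewrite lee_fin => Pp M0.
  have p0 : 0 < p by exact: lt_le_trans Pp.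
  have bfp := bounded_measurable_normc_powR (ltW p0) bf.
  pose A := circle_avg (fun t => normc (f (circle_point r t)) `^ p).
  have A0 : 0 <= A by apply: circle_avg_ge0 => t; exact: powR_ge0.
  have -> : (((2 * pi)^-1%:E * \int[lebesgue_measure]_(t in `[0%R, (2 * pi)%R])
      ((normc (f (circle_point r t)) `^ p)%:E)) `^ p^-1 = (A `^ p^-1)%:E)%E.
    rewrite -poweR_EFin; congr (_ `^ _)%E.
    rewrite /A /circle_avg EFinM /Rintegral fineK//.
    apply: integrable_fin_num => //.
    exact: bounded_measurable_integrable.
  rewrite lee_fin => AM.
  have {}AM : A <= M `^ p.
    have -> : A = (A `^ p^-1) `^ p by rewrite -powRrM mulVf ?powRr1// gt_eqF.
    by apply: ge0_ler_powR; rewrite ?nnegrE ?powR_ge0 ?(ltW p0) ?(ltW M0).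
  apply: (@le_trans _ _ (circle_avg (fun t =>
      M `^ P + M `^ (P - p) * normc (f (circle_point r t)) `^ p))).
    apply: le_circle_avg => //.
      apply: bounded_measurableD; first exact: bounded_measurable_cst.
      exact: bounded_measurableZ.
    move=> t _; set x := normc _.
    have x0 : 0 <= x by exact: normc_ge0.
    have [xM|Mx] := leP x M.
      rewrite ler_wpDr ?mulr_ge0 ?powR_ge0//.
      by apply: ge0_ler_powR; rewrite ?nnegrE ?(ltW P_gt0) ?(ltW M0).
    have xgt0 : 0 < x by exact: lt_trans Mx.
    rewrite ler_wpDl ?powR_ge0//.
    have -> : x `^ P = x `^ (P - p) * x `^ p.
      by rewrite -powRD ?subrK// (gt_eqF xgt0) implybT.
    rewrite ler_wpM2r ?powR_ge0//.
    rewrite -(opprB p P) !powRN lef_pV2 ?posrE ?powR_gt0//.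
    by apply: ge0_ler_powR; rewrite ?nnegrE ?subr_ge0 ?(ltW M0) ?(ltW xgt0) ?(ltW Mx).
  rewrite circle_avgD ?circle_avgZ ?circle_avg_cst//; last first.
  + exact: bounded_measurableZ.
  + exact: bounded_measurable_cst.
  rewrite mulr2n mulrDl mul1r lerD2l -/A.
  apply: le_trans (ler_wpM2l (powR_ge0 _ _) AM) _.
  by rewrite -powRD ?subrK// (gt_eqF M0) implybT.
- move=> _ M0 fM; apply: (@le_trans _ _ (circle_avg (fun=> M `^ P))).
    apply: le_circle_avg => //; first exact: bounded_measurable_cst.
    move=> t tI; apply: ge0_ler_powR; rewrite ?nnegrE ?normc_ge0 ?(ltW P_gt0) ?(ltW M0)//.
    rewrite -lee_fin; apply: le_trans fM; apply: ereal_sup_ubound.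
    by exists t.
  by rewrite circle_avg_cst mulr2n mulrDl mul1r lerDl powR_ge0.
Qed.

Lemma pairing_le_integral_mean (f : CC R -> CC R) (a : nat -> CC R)
    (p : \bar R) (r lam M : R) (K : nat) (c : nat -> R[i]) :
  has_expansion f a -> 0 <= r -> r < 1 -> (P%:E <= p)%E ->
  0 <= lam -> 0 < M -> (forall k, (K <= k)%N -> c k = 0) ->
  (integral_mean p f r <= M%:E)%E ->
  lam * (\sum_(k < K) r ^+ k * Re (a k * conjc (c k))) <=
  2 * (lam * M) `^ P + circle_avg (fun t => normc (trig_poly K c t) `^ Q).
Proof.
move=> fa r0 r1 Pp lam0 M0 c0 fM.
apply: le_trans (pairing_young fa r0 r1 lam0 c0) _; rewrite lerD2r.
rewrite powRM ?(ltW M0)// [leRHS]mulrCA ler_wpM2l ?powR_ge0//.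
exact: circle_avg_le_integral_mean fa r0 r1 Pp M0 fM.
Qed.

(** If the mean were smaller, rescaling would make the pairing [v] exceed what
    the mean and the unit ball of [L^Q] allow together. *)
Lemma integral_mean_ge (f : CC R -> CC R) (a : nat -> CC R)
    (p : \bar R) (r v : R) (K : nat) (c : nat -> R[i]) :
  has_expansion f a -> 0 <= r -> r < 1 -> (P%:E <= p)%E ->
  0 < v -> (forall k, (K <= k)%N -> c k = 0) ->
  v <= \sum_(k < K) r ^+ k * Re (a k * conjc (c k)) ->
  circle_avg (fun t => normc (trig_poly K c t) `^ Q) <= 1 ->
  ((v / 8)%:E <= integral_mean p f r)%E.
Proof.
move=> fa r0 r1 Pp v0 c0 vle avg1; rewrite leNgt; apply/negP => /ltW fM.
have l0 : 0 <= 2 / v by rewrite divr_ge0// ltW.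
have M0 : 0 < v / 8 by rewrite divr_gt0.
(* The scale [lam = 2 / v] makes the left side at least [2], while
   [lam * M = 1 / 4] makes the right side at most [2 * (1 / 4) + 1]. *)
have := pairing_le_integral_mean fa r0 r1 Pp l0 M0 c0 fM.
have -> : 2 / v * (v / 8) = 4^-1 by field; rewrite gt_eqF.
have h1 : (4^-1 : R) `^ P <= 4^-1 by apply: ge1r_powR => //; apply/andP; split; lra.
have h2 := ler_wpM2l l0 vle.
rewrite divfK ?gt_eqF// in h2.
lra.
Qed.

(** Convexity of [x `^ Q]: the graph lies above its tangent at [x + y]. *)
Lemma powR_tangent (x y : R) : 0 <= x -> 0 <= y ->
  (x + y) `^ Q <= x `^ Q + Q * ((x + y) `^ (Q - 1) * y).
Proof.
move=> x0 y0; have z0 : 0 <= x + y by rewrite addr_ge0.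
have := conjugate_powR x0 (powR_ge0 (x + y) (Q - 1)) Q_gt0 P_gt0.
rewrite addrC => /(_ PQ).
have QP : (Q - 1) * P = Q.
  have : P * Q * (P^-1 + Q^-1) = P * Q by rewrite PQ mulr1.
  rewrite mulrDr mulrAC divff ?gt_eqF// mulfK ?gt_eqF//.
  lra.
rewrite -powRrM QP => h.
have E : (x + y) `^ Q = (x + y) * (x + y) `^ (Q - 1) by rewrite mulr_powRB1.
have Pi : P^-1 = 1 - Q^-1 by rewrite -PQ addrK.
rewrite Pi in h.
have := ler_wpM2l (ltW Q_gt0) h.
have k1 : Q * (x `^ Q / Q) = x `^ Q by field; rewrite gt_eqF.
have k2 u : Q * (u * (1 - Q^-1)) = Q * u - u by field; rewrite gt_eqF.
rewrite mulrDr k1 k2 E; lra.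
Qed.

(** For [y <= H] the tangent inequality gives the error [A * y <= 1 + A ^ 2 * y ^ 2]
    with [A] depending on [H] only; for [y > H] both terms are at most [y]. *)
Lemma powRD_le (H : R) : 0 <= H -> exists2 D : R, 0 <= D &
  forall x y : R, 0 <= x -> x <= H -> 0 <= y ->
    (x + y) `^ Q <= x `^ Q + 1 + 2 `^ Q * y `^ Q + D * y ^+ 2.
Proof.
move=> H0; pose A := Q * (H + H) `^ (Q - 1).
have A0 : 0 <= A by rewrite mulr_ge0 ?powR_ge0 ?(ltW Q_gt0).
exists (A ^+ 2); first exact: sqr_ge0.
move=> x y x0 xH y0.
have [yH|Hy] := leP y H.
  apply: le_trans (powR_tangent x0 y0) _.
  rewrite -!addrA lerD2l.
  apply: (@le_trans _ _ (A * y)).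
    rewrite mulrA ler_wpM2r// ler_wpM2l ?(ltW Q_gt0)//.
    have Q1 : 0 <= Q - 1 by rewrite subr_ge0 (le_trans _ Q_ge2)// ler1n.
    by apply: (ge0_ler_powR Q1); rewrite ?nnegrE ?addr_ge0 ?lerD.
  rewrite addrCA ler_wpDl ?mulr_ge0 ?powR_ge0//.
  have := sqr_ge0 (A * y - 1); nra.
apply: (@le_trans _ _ (2 `^ Q * y `^ Q)).
  rewrite -powRM//; apply: ge0_ler_powR; rewrite ?nnegrE ?addr_ge0 ?mulr_ge0 ?(ltW Q_gt0)//.
  by rewrite mulr2n mulrDl mul1r lerD2r (le_trans xH)// ltW.
have h1 := powR_ge0 x Q.
have h2 : 0 <= A ^+ 2 * y ^+ 2 by rewrite mulr_ge0 ?sqr_ge0.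
lra.
Qed.

End duality.

(** * Test polynomials on blocks *)

Section phase.
Variable R : realType.

(** This is [0] at [z = 0], so that pairing with the phase gives the modulus for
    every [z]. *)
Definition phase (z : R[i]) : R[i] := z * ((normc z)^-1)%:C.

Lemma normc_phase_le1 z : normc (phase z) <= 1.
Proof.
rewrite Normc.normcM normc_real normfV ger0_norm ?normc_ge0//.
by have [->|z0] := eqVneq (normc z) 0; [rewrite invr0 mulr0 ler01 | rewrite divff].
Qed.

Lemma Re_mul_phase z (s : R) : Re (z * conjc (s%:C * phase z)) = s * normc z.
Proof.
rewrite /phase conjcM conjcM !conjc_real mulrCA ReZ; congr (_ * _).
rewrite mulrA mulrC ReZ ReMJ expr2 mulrA.
by have [->|z0] := eqVneq (normc z) 0; rewrite ?mulr0// mulVf ?mul1r.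
Qed.

Lemma bernoulli_exprn (x r : R) (n : nat) : 0 <= x -> x <= 1 -> 1 - x <= r ->
  1 - n%:R * x <= r ^+ n.
Proof.
move=> x0 x1 xr; have r0 : 0 <= r by lra.
apply: (@le_trans _ _ ((1 - x) ^+ n)); last by rewrite lerXn2r// nnegrE; lra.
elim: n => [|n IH]; first by rewrite mul0r subr0 expr0.
have y0 : 0 <= 1 - x by lra.
rewrite exprS -natr1; have := ler_wpM2l y0 IH.
have := mulr_ge0 (ler0n R n) (sqr_ge0 x); lra.
Qed.

Lemma powR_le_2 (x alpha : R) : 2^-1 <= x -> x <= 2 ->
  x `^ alpha <= 2 `^ `|alpha|.
Proof.
move=> x1 x2; have x0 : 0 < x by lra.
rewrite /powR !gt_eqF// ler_expR; apply: le_trans (ler_norm _) _.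
rewrite normrM ler_wpM2l// ler_norml; apply/andP; split.
  by rewrite -lnV ?posrE// ler_ln ?posrE ?invr_gt0.
by rewrite ler_ln ?posrE.
Qed.

End phase.

Section block.
Variables (R : realType) (P Q : R).
Hypotheses (Q_ge2 : 2 <= Q) (PQ : P^-1 + Q^-1 = 1).

Let Q_gt0 : 0 < Q. Proof. by apply: lt_le_trans Q_ge2. Qed.

(** [|w| ^ Q <= H ^ (Q - 2) |w| ^ 2]: with Parseval this bounds the [L^Q] norm of
    a polynomial whose coefficients have modulus at most [s] on a set of [m]
    frequencies, and the choice [s = m ^ (- 1 / P)] makes the bound [1]. *)
Lemma circle_avg_flat (K : nat) (c : nat -> R[i]) (B : pred nat) (s m : R) :
  0 < m -> m = \sum_(k < K | B k) 1 -> s = m `^ (- P^-1) ->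
  (forall k, normc (c k) <= if B k then s else 0) ->
  \sum_(k < K) normc (c k) ^+ 2 <= m `^ (1 - 2 / P) /\
  circle_avg (fun t => normc (trig_poly K c t) `^ Q) <= 1.
Proof.
move=> m0 mE sE cB.
have s0 : 0 < s by rewrite sE powR_gt0.
have sumB u : \sum_(k < K) (if B k then u else 0) = m * u.
  by rewrite -big_mkcond mE mulr_suml; apply: eq_bigr => k _; rewrite mul1r.
have msm : m * s = m `^ Q^-1.
  rewrite sE -[X in X * _ = _]powRr1 ?(ltW m0)// -powRD ?(gt_eqF m0) ?implybT//.
  by rewrite -PQ addrAC subrr add0r.
have msq : m * s ^+ 2 = m `^ (1 - 2 / P).
  rewrite sE -powR_mulrn ?powR_ge0// -powRrM.
  rewrite -[X in X * _ = _]powRr1 ?(ltW m0)// -powRD ?(gt_eqF m0) ?implybT//.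
  by rewrite mulNr [_ * 2]mulrC.
have c2 : \sum_(k < K) normc (c k) ^+ 2 <= m `^ (1 - 2 / P).
  rewrite -msq -sumB; apply: ler_sum => k _; have := cB k.
  case: ifP => _ ck; first by rewrite lerXn2r// nnegrE ?normc_ge0 ?(ltW s0).
  have /eqP -> : normc (c k) == 0 by rewrite eq_le ck normc_ge0.
  by rewrite expr0n.
split=> //.
have H t : normc (trig_poly K c t) <= m * s.
  apply: le_trans (normc_trig_poly_le _ _ _) _.
  by rewrite -sumB; apply: ler_sum => k _.
have bP := cbounded_measurable_trig_poly K c.
have b2 : bounded_measurable (fun t => normc (trig_poly K c t) ^+ 2).
  by apply: bounded_measurableM; exact: bounded_measurable_normc.
apply: (@le_trans _ _ (circle_avg (fun t =>
    (m * s) `^ (Q - 2) * normc (trig_poly K c t) ^+ 2))).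
  apply: le_circle_avg.
  - exact/bounded_measurable_normc_powR/bP/ltW.
  - exact: bounded_measurableZ.
  move=> t _; set x := normc _; have x0 : 0 <= x by exact: normc_ge0.
  have [->|xn0] := eqVneq x 0.
    by rewrite powR0 ?gt_eqF// expr0n mulr0.
  have -> : x `^ Q = x `^ (Q - 2) * x ^+ 2.
    by rewrite -powR_mulrn// -powRD ?subrK// xn0 implybT.
  rewrite ler_wpM2r ?sqr_ge0//; apply: ge0_ler_powR; last exact: H.
  - by rewrite subr_ge0.
  - by rewrite nnegrE.
  - by rewrite nnegrE mulr_ge0// ltW.
rewrite circle_avgZ// circle_avg_parseval.
apply: le_trans (ler_wpM2l (powR_ge0 _ _) c2) _.
rewrite msm -powRrM -powRD ?(gt_eqF m0) ?implybT//.
have -> : Q^-1 * (Q - 2) + (1 - 2 / P) = 0.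
  have -> : P^-1 = 1 - Q^-1 by rewrite -PQ addrK.
  by field; rewrite gt_eqF.
by rewrite powRr0.
Qed.

Variables (alpha gamma : R) (a : nat -> CC R).
Hypotheses (gamma_gt0 : 0 < gamma) (gamma_lt1 : gamma < 1).
Hypothesis aE :
  beta_dense gamma [set n | 1 <= n.+1%:R `^ alpha * normc (a n)].

(** Test polynomials carried by the indices of [(N / 2, N]] where the
    coefficients of [f] are large, with the phases of these coefficients. *)
Lemma block_poly : exists2 kap : R, 0 < kap & forall e : R, 0 < e ->
  forall M : nat, exists (N : nat) (c : nat -> R[i]),
  [/\ (M <= N)%N && (0 < N)%N,
      forall k, (k.*2 <= N)%N || (N < k)%N -> c k = 0,
      forall r, 1 - (2 * N%:R)^-1 <= r -> r <= 1 ->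
        kap * N%:R `^ ((1 - gamma) / Q - alpha) <=
        \sum_(k < N.+1) r ^+ k * Re (a k * conjc (c k)),
      circle_avg (fun t => normc (trig_poly N.+1 c t) `^ Q) <= 1 &
      (2 < Q -> \sum_(k < N.+1) normc (c k) ^+ 2 <= e)].
Proof.
have [d d0 H] := beta_dense_block gamma_gt0 gamma_lt1 aE.
set E := [set n | _] in H *.
pose kap : R := d `^ Q^-1 / 2 `^ `|alpha| / 2.
exists kap; first by rewrite !divr_gt0 ?powR_gt0.
move=> e e0 M.
have g1 : 0 < 1 - gamma by rewrite subr_gt0.
(* Beyond this threshold [m ^ (1 - 2 / P) <= e], the exponent being negative
   when [Q > 2]. *)
have [N0 HN0] := powR_nat_large (e `^ (1 - 2 / P)^-1 / d) g1.
have [N] := H (maxn (maxn M N0) 1); rewrite !geq_max -andbA => /and3P[MN N0N Np].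
pose B k := (N < k.*2)%N && (k \in E).
set m := \sum_(_ < _ | _) _ => dm.
have N0' : 0 < N%:R :> R by rewrite ltr0n.
have dN0 : 0 < d * N%:R `^ (1 - gamma) by rewrite mulr_gt0// powR_gt0.
have m0 : 0 < m by exact: lt_le_trans dm.
pose s := m `^ (- P^-1).
have s0 : 0 < s by rewrite powR_gt0.
pose c k : R[i] := if B k && (k <= N)%N then s%:C * phase (a k) else 0.
have cB k : normc (c k) <= if B k then s else 0.
  rewrite /c; case: ifP => [/andP[-> _]|_]; last first.
    by rewrite Normc.normc0; case: (B k) => //; exact: ltW.
  rewrite Normc.normcM normc_real ger0_norm ?(ltW s0)//.
  by rewrite ler_piMr ?(ltW s0)// normc_phase_le1.
have [c2 cQ] := circle_avg_flat m0 (erefl : m = \sum_(k < N.+1 | B k) 1) erefl cB.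
exists N, c; split => //.
- by rewrite MN.
- by move=> k /orP[kN|Nk]; rewrite /c /B; [rewrite ltnNge kN | rewrite [(k <= N)%N]leqNgt Nk andbF].
- move=> r r1 r2.
  (* As [N / 2 <= k + 1 <= 2 N], replacing [k + 1] by [N] costs [2 ^ |alpha|]. *)
  have alow (k : 'I_N.+1) : B k ->
      N%:R `^ (- alpha) / 2 `^ `|alpha| <= normc (a k).
    move=> /andP[Nk]; rewrite inE /= => ak.
    have kN : (k <= N)%N by rewrite -ltnS.
    rewrite ler_pdivrMr ?powR_gt0// powRN -[leLHS]mulr1 ler_pdivrMl ?powR_gt0//.
    apply: le_trans ak _; rewrite [leLHS]mulrC [leRHS]mulrCA ler_wpM2l ?normc_ge0//.
    have -> : k.+1%:R = N%:R * (k.+1%:R / N%:R) :> R.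
      by rewrite mulrC divfK// gt_eqF.
    rewrite powRM ?divr_ge0 ?(ltW N0')// ler_wpM2l ?powR_ge0//.
    apply: powR_le_2.
      rewrite ler_pdivlMr// mulrC ler_pdivrMr// -natrM ler_nat muln2.
      by apply: leq_trans (ltnW Nk) _; rewrite leq_double.
    rewrite ler_pdivrMr// -natrM ler_nat.
    by rewrite mul2n -addnn -addn1; apply: leq_add.
  (* Bernoulli: the powers of [r] are at least [1 / 2] up to the exponent [N]. *)
  have x0 : 0 <= (2 * N%:R)^-1 :> R by rewrite invr_ge0 mulr_ge0.
  have x1 : (2 * N%:R)^-1 <= 1 :> R.
    rewrite invf_le1 ?mulr_gt0// -natrM ler1n muln_gt0/=; exact: Np.
  have r0 : 0 <= r by lra.
  have rk (k : 'I_N.+1) : 2^-1 <= r ^+ k.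
    have kN : (k <= N)%N by rewrite -ltnS.
    apply: le_trans (bernoulli_exprn k x0 x1 r1).
    have : k%:R * (2 * N%:R)^-1 <= 2^-1 :> R.
      rewrite ler_pdivrMr ?mulr_gt0// mulrA mulVf// mul1r.
      by rewrite ler_nat.
    lra.
  apply: (@le_trans _ _ (m * (s * (2^-1 * (N%:R `^ (- alpha) / 2 `^ `|alpha|))))).
    rewrite mulrA.
    have -> : m * s = m `^ Q^-1.
      rewrite /s -[X in X * _ = _]powRr1 ?(ltW m0)// -powRD ?(gt_eqF m0) ?implybT//.
      by rewrite -PQ addrAC subrr add0r.
    have -> : kap * N%:R `^ ((1 - gamma) / Q - alpha) =
        (d * N%:R `^ (1 - gamma)) `^ Q^-1 *
        (2^-1 * (N%:R `^ (- alpha) / 2 `^ `|alpha|)).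
      rewrite powRM ?powR_ge0 ?(ltW d0)// -powRrM.
      rewrite powRD ?(gt_eqF N0') ?implybT// /kap.
      by field; rewrite gt_eqF// powR_gt0.
    rewrite ler_wpM2r ?mulr_ge0 ?invr_ge0 ?powR_ge0//.
    apply: ge0_ler_powR; rewrite ?invr_ge0 ?nnegrE ?(ltW m0) ?(ltW dN0)//.
    exact: ltW.
  rewrite /m mulr_suml big_mkcond; apply: ler_sum => k _.
  rewrite -/(B k) /c -ltnS ltn_ord andbT; case: ifPn => Bk; last first.
    by rewrite conjc0 mulr0 mulr0.
  rewrite mul1r Re_mul_phase [leRHS]mulrCA ler_wpM2l ?(ltW s0)//.
  apply: ler_pM; rewrite ?rk ?alow ?divr_ge0 ?powR_ge0 ?invr_ge0//.
- move=> Q2; apply: le_trans c2 _.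
  have Pm : 1 - 2 / P < 0.
    have -> : P^-1 = 1 - Q^-1 by rewrite -PQ addrK.
    have : Q^-1 < 2^-1 by rewrite ltf_pV2 ?posrE.
    lra.
  have em : e `^ (1 - 2 / P)^-1 <= m.
    apply: le_trans dm; rewrite [leRHS]mulrC -ler_pdivrMr//; exact: HN0.
  have -> : e = (e `^ (1 - 2 / P)^-1) `^ (1 - 2 / P).
    by rewrite -powRrM mulVf ?powRr1 ?(ltW e0)// lt_eqF.
  have powE y : y `^ (1 - 2 / P) = (y `^ (- (1 - 2 / P)))^-1.
    by rewrite -powRN opprK.
  rewrite (powE m) (powE (e `^ _)) lef_pV2 ?posrE ?powR_gt0//.
  by apply: ge0_ler_powR; rewrite ?nnegrE ?powR_ge0 ?(ltW m0)// oppr_ge0 ltW.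
Qed.

End block.

(** * Superposition of blocks at the critical exponent *)

Section multi_block.
Variables (R : realType) (P Q : R).
Hypotheses (P_ge1 : 1 <= P) (Q_ge2 : 2 <= Q) (PQ : P^-1 + Q^-1 = 1).

Let Q_gt0 : 0 < Q. Proof. by apply: lt_le_trans Q_ge2. Qed.

Lemma bounded_measurable_normc_sqr (F : R -> R[i]) : cbounded_measurable F ->
  bounded_measurable (fun t => normc (F t) ^+ 2).
Proof. by move=> bF; apply: bounded_measurableM; exact: bounded_measurable_normc. Qed.

(** For [Q > 2], adding a polynomial of small [L^2] norm nearly adds the
    [Q]-th powers of the [L^Q] norms: the two polynomials are large on nearly
    disjoint sets.  Half of the error [2] is that of [powRD_le], the other half
    is the mean square of the added polynomial times its constant [D]. *)
Lemma circle_avg_almost_additive K (c : nat -> R[i]) :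
  exists2 e : R, 0 < e & forall N (d : nat -> R[i]), (K <= N)%N ->
    (forall k, (K <= k)%N -> c k = 0) ->
    \sum_(k < N) normc (d k) ^+ 2 <= e ->
    circle_avg (fun t => normc (trig_poly N (fun k => c k + d k) t) `^ Q) <=
    circle_avg (fun t => normc (trig_poly K c t) `^ Q) + 2 +
    2 `^ Q * circle_avg (fun t => normc (trig_poly N d t) `^ Q).
Proof.
pose H := \sum_(k < K) normc (c k).
have H0 : 0 <= H by rewrite sumr_ge0// => k _; exact: normc_ge0.
have [D D0 HD] := powRD_le P_ge1 Q_ge2 PQ H0.
exists (D + 1)^-1; first by rewrite invr_gt0; lra.
move=> N d KN c0 de.
have bc := cbounded_measurable_trig_poly K c.
have bd := cbounded_measurable_trig_poly N d.
have bcQ := bounded_measurable_normc_powR (ltW Q_gt0) bc.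
have bdQ := bounded_measurable_normc_powR (ltW Q_gt0) bd.
have bd2 := bounded_measurable_normc_sqr bd.
apply: (@le_trans _ _ (circle_avg (fun t =>
    normc (trig_poly K c t) `^ Q + 1 +
    2 `^ Q * normc (trig_poly N d t) `^ Q +
    D * normc (trig_poly N d t) ^+ 2))).
  apply: le_circle_avg.
  - apply: bounded_measurable_normc_powR (ltW Q_gt0) _.
    exact: cbounded_measurable_trig_poly.
  - do ?apply: bounded_measurableD => //; try exact: bounded_measurableZ.
    exact: bounded_measurable_cst.
  move=> t _; rewrite trig_polyD (trig_poly_widen _ KN c0).
  set x := trig_poly K c t; set y := trig_poly N d t.
  have xH : normc x <= H by exact: normc_trig_poly_le.
  apply: le_trans (HD _ _ (normc_ge0 x) xH (normc_ge0 y)).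
  apply: ge0_ler_powR; rewrite ?nnegrE ?addr_ge0 ?normc_ge0 ?(ltW Q_gt0)//.
  exact: le_normcD.
have b1 := bounded_measurable_cst (1 : R).
rewrite circle_avgD; last 2 first.
- by apply: bounded_measurableD; [exact: bounded_measurableD |
    exact: bounded_measurableZ].
- exact: bounded_measurableZ.
rewrite circle_avgD; [|exact: bounded_measurableD|exact: bounded_measurableZ].
rewrite circle_avgD// circle_avg_cst !circle_avgZ// circle_avg_parseval.
have : D * \sum_(k < N) normc (d k) ^+ 2 <= 1.
  apply: le_trans (ler_wpM2l D0 de) _.
  by rewrite ler_pdivrMr; lra.
move: (D * _) (2 `^ Q * _) (circle_avg _) => u v w; lra.
Qed.

(** Parseval, the two families of coefficients having disjoint supports. *)
Lemma circle_avg_additive2 K (c d : nat -> R[i]) N : Q = 2 -> (K <= N)%N ->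
  (forall k, (K <= k)%N -> c k = 0) -> (forall k, (k < K)%N -> d k = 0) ->
  circle_avg (fun t => normc (trig_poly N (fun k => c k + d k) t) `^ Q) =
  circle_avg (fun t => normc (trig_poly K c t) `^ Q) +
  circle_avg (fun t => normc (trig_poly N d t) `^ Q).
Proof.
move=> Q2 KN c0 d0.
have E M b : circle_avg (fun t => normc (trig_poly M b t) `^ Q) =
    \sum_(k < M) normc (b k) ^+ 2 :> R.
  rewrite -circle_avg_parseval; congr circle_avg; apply/funext => t.
  by rewrite Q2 powR_mulrn// normc_ge0.
rewrite !E (big_ord_widen N (fun k => normc (c k) ^+ 2) KN).
rewrite [X in _ = X + _]big_mkcond -big_split/=; apply: eq_bigr => k _.
have [kK|Kk] := ltnP k K; first by rewrite d0// Normc.normc0 expr0n !addr0.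
by rewrite c0// !add0r.
Qed.

Variables (alpha gamma : R) (a : nat -> CC R).
Hypotheses (gamma_gt0 : 0 < gamma) (gamma_lt1 : gamma < 1).
Hypothesis aE :
  beta_dense gamma [set n | 1 <= n.+1%:R `^ alpha * normc (a n)].
Hypothesis alphaE : alpha = (1 - gamma) / Q.

(** At the critical exponent every block contributes the same amount to the
    pairing; [J] blocks give [J], whereas the [L^Q] norm only grows like
    [J ^ (1 / Q)]. *)
Lemma multi_block_poly : exists2 kap : R, 0 < kap & exists2 C : R, 0 < C &
  forall J : nat, exists (K : nat) (c : nat -> R[i]) (r0 : R),
  [/\ 0 <= r0 < 1,
      forall k, (K <= k)%N -> c k = 0,
      forall r, r0 <= r -> r <= 1 ->
        kap * J%:R <= \sum_(k < K) r ^+ k * Re (a k * conjc (c k)) &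
      circle_avg (fun t => normc (trig_poly K c t) `^ Q) <= C * J%:R].
Proof.
have [kap kap0 Hblock] := block_poly Q_ge2 PQ gamma_gt0 gamma_lt1 aE.
exists kap => //; pose C : R := 2 + 2 `^ Q.
have Q20 : 0 < 2 `^ Q :> R by rewrite powR_gt0.
have C0 : 0 < C by rewrite /C; lra.
exists C => //; elim=> [|J [K [c [r0 [/andP[r00 r01] cK cpair cQ]]]]].
  exists 0%N, (fun=> 0), 0; split => //.
  - by rewrite lexx ltr01.
  - by move=> r _ _; rewrite big_ord0 mulr0.
  - rewrite mulr0 /trig_poly; under eq_fun do rewrite big_ord0.
    by rewrite circle_avg_cst Normc.normc0 powR0// gt_eqF.
have [e e0 He] := circle_avg_almost_additive K c.
(* With [N >= 2 K] the new block [(N / 2, N]] lies beyond the frequencies used so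
   far, and its [L^2] norm is below the threshold that they determine. *)
have [N [d [/andP[KN N0] d0 dpair dQ d2]]] := Hblock e e0 K.*2.
have KN1 : (K <= N.+1)%N.
  by apply: leqW; apply: leq_trans KN; rewrite -addnn leq_addr.
have N0' : 0 < N%:R :> R by rewrite ltr0n.
have x0 : 0 < (2 * N%:R)^-1 :> R by rewrite invr_gt0 mulr_gt0.
exists N.+1, (fun k => c k + d k), (Num.max r0 (1 - (2 * N%:R)^-1)).
split.
- by rewrite le_max r00/= gt_max r01/= ltrBlDr ltrDl.
- move=> k Nk; rewrite cK ?d0 ?addr0//; first by rewrite Nk orbT.
  exact: leq_trans Nk.
- move=> r; rewrite ge_max => /andP[rr0 rN] r1.
  have := dpair r rN r1; rewrite alphaE subrr powRr0 mulr1 => dk.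
  have -> : \sum_(k < N.+1) r ^+ k * Re (a k * conjc (c k + d k)) =
      \sum_(k < K) r ^+ k * Re (a k * conjc (c k)) +
      \sum_(k < N.+1) r ^+ k * Re (a k * conjc (d k)).
    rewrite (big_ord_widen N.+1 (fun k => r ^+ k * Re (a k * conjc (c k))) KN1).
    rewrite [X in _ = X + _]big_mkcond -big_split/=; apply: eq_bigr => k _.
    rewrite conjcD mulrDr ReD mulrDr; case: ltnP => // Kk.
    by rewrite cK// conjc0 mulr0 mulr0.
  by rewrite -natr1 mulrDr mulr1 lerD// cpair.
- rewrite -natr1 mulrDr mulr1.
  have [Q2|Q2] := ltP 2 Q.
    apply: le_trans (He _ _ KN1 cK (d2 Q2)) _; rewrite -addrA; apply: lerD => //.
    by rewrite /C lerD2l ler_piMr ?(ltW Q20).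
  have QE : Q = 2 by apply/eqP; rewrite eq_le Q2 Q_ge2.
  rewrite (circle_avg_additive2 QE KN1)//; last first.
    move=> k kK; apply: d0; apply/orP; left; apply: leq_trans KN.
    by rewrite leq_double ltnW.
  apply: lerD => //; apply: le_trans dQ _; rewrite /C; lra.
Qed.

End multi_block.

(** * Growth of the means *)

Lemma limf_esup_at_left_ge (R : realType) (g : R -> \bar R) (x : R) (k : \bar R) :
  (forall y : R, y < x -> exists r, [/\ y < r, r < x & (k <= g r)%E]) ->
  (k <= limf_esup g x^'-)%E.
Proof.
move=> H; apply: le_ereal_inf_tmp => _ [V [e /= e0 He] <-].
have [|r [yr rx kr]] := H (x - e); first by rewrite ltrBlDr ltrDl.
apply: le_trans kr _; apply: ereal_sup_ubound; exists r => //.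
apply: He => //=; rewrite ger0_norm ?subr_ge0 ?ltW//; lra.
Qed.

(** Passing from [q] to [max(2, q)] can only decrease the conjugate exponent, which
    therefore stays below [p]. *)
Lemma conjugate_exponents (R : realType) (p : \bar R) (q : R) :
  (1%E < p)%E -> hoelder_conjugate p = q%:E ->
  let Q := Num.max 2 q in let P := (1 - Q^-1)^-1 in
  [/\ 1 <= P, 2 <= Q, P^-1 + Q^-1 = 1 & (P%:E <= p)%E].
Proof.
move=> p1 pq Q P.
have Q2 : 2 <= Q by rewrite /Q le_max lexx.
have Q0 : 0 < Q by lra.
have Qi : Q^-1 <= 2^-1 by rewrite lef_pV2 ?posrE.
have Qi0 : 0 < Q^-1 by rewrite invr_gt0.
split => //.
- by rewrite /P invf_ge1; lra.
- by rewrite /P invrK subrK.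
move: p p1 pq => [p| |//]; last by rewrite leey.
rewrite lte_fin => p1 pq; have p0 : 0 < p by lra.
have : (p%:E)^-1%E + (q%:E)^-1%E = 1%E :> \bar R.
  have pn0 : p%:E != 0%E by rewrite eqe gt_eqF.
  by rewrite -pq; apply: hoelder_conjugate_eq1 => //; rewrite ltNyr.
have q1 : 1 <= q by rewrite -lee_fin -pq hoelder_conj_ge1// lee_fin ltW.
have q0 : 0 < q by lra.
rewrite !inver !gt_eqF// -EFinD => -[pqE].
have : Q^-1 <= q^-1 by rewrite lef_pV2 ?posrE// /Q le_max lexx orbT.
rewrite lee_fin /P => Qq.
rewrite -[leRHS]invrK lef_pV2 ?posrE ?invr_gt0//; last by lra.
lra.
Qed.

Section growth.
Variables (R : realType) (P Q alpha gamma : R) (p : \bar R).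
Variables (f : CC R -> CC R) (a : nat -> CC R).
Hypotheses (P_ge1 : 1 <= P) (Q_ge2 : 2 <= Q) (PQ : P^-1 + Q^-1 = 1).
Hypothesis Pp : (P%:E <= p)%E.
Hypotheses (gamma_gt0 : 0 < gamma) (gamma_lt1 : gamma < 1).
Hypothesis fa : has_expansion f a.
Hypothesis aE :
  beta_dense gamma [set n | 1 <= n.+1%:R `^ alpha * normc (a n)].

Let Q_gt0 : 0 < Q. Proof. by apply: lt_le_trans Q_ge2. Qed.

Lemma growth_power :
  (0 < limf_esup (fun r : R => ((1 - r) `^ ((1 - gamma) / Q - alpha))%:E
                    * integral_mean p f r) 1%R^'-)%E.
Proof.
set b := (1 - gamma) / Q - alpha.
have [kap kap0 Hblock] := block_poly Q_ge2 PQ gamma_gt0 gamma_lt1 aE.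
pose k := (2^-1 : R) `^ b * (kap / 8).
have k0 : 0 < k by rewrite mulr_gt0 ?powR_gt0 ?divr_gt0.
apply: (@lt_le_trans _ _ k%:E); first by rewrite lte_fin.
apply: limf_esup_at_left_ge => y y1.
have [N [c [/andP[MN N0] c0 cpair cQ _]]] :=
  Hblock 1 ltr01 (Num.bound (1 - y)^-1).
have N0' : 0 < N%:R :> R by rewrite ltr0n.
have x0 : 0 < (2 * N%:R)^-1 :> R by rewrite invr_gt0 mulr_gt0.
have xle : (2 * N%:R)^-1 <= 2^-1 :> R.
  by rewrite lef_pV2 ?posrE ?mulr_gt0// ler_pMr// ler1n.
pose r : R := 1 - (2 * N%:R)^-1.
have r1 : r < 1 by rewrite /r; lra.
have r0 : 0 <= r by rewrite /r; lra.
exists r; split => //.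
  have y0 : 0 < 1 - y by lra.
  have : (1 - y)^-1 < N%:R.
    apply: lt_le_trans (archi_boundP _) _; first by rewrite invr_ge0 ltW.
    by rewrite ler_nat.
  rewrite invf_plt ?posrE// => Ny.
  have : (2 * N%:R)^-1 <= N%:R^-1 :> R.
    by rewrite lef_pV2 ?posrE ?mulr_gt0// ler_pMl//; lra.
  rewrite /r; lra.
have v0 : 0 < kap * N%:R `^ b by rewrite mulr_gt0 ?powR_gt0.
have cN k' : (N.+1 <= k')%N -> c k' = 0 by move=> h; apply: c0; rewrite h orbT.
have mean := integral_mean_ge P_ge1 Q_ge2 PQ fa r0 r1 Pp v0 cN
  (cpair r (lexx _) (ltW r1)) cQ.
have -> : k%:E = (((1 - r) `^ b)%:E * (kap * N%:R `^ b / 8)%:E)%E.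
  rewrite -EFinM; congr EFin; rewrite /r opprB addrC subrK invfM.
  rewrite powRM ?invr_ge0// /k -[N%:R^-1]powR_inv1 ?ler0n// -powRrM mulN1r powRN.
  by field; rewrite gt_eqF// powR_gt0.
by apply: lee_wpmul2l => //; rewrite lee_fin powR_ge0.
Qed.

Lemma growth_critical : alpha = (1 - gamma) / Q ->
  limf_esup (integral_mean p f) 1%R^'- = +oo%E.
Proof.
move=> alphaE.
have [kap kap0 [C C0 HJ]] :=
  multi_block_poly P_ge1 Q_ge2 PQ gamma_gt0 gamma_lt1 aE alphaE.
apply/eqyP => A A0; apply: limf_esup_at_left_ge => y y1.
(* This scale makes the pairing [2 C J], twice the bound [C J] on the test
   polynomial, so the fixed quantity [2 (lam A) ^ P] would dominate [C J]. *)
pose lam := 2 * C / kap.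
have lam0 : 0 < lam by rewrite divr_gt0// mulr_gt0.
pose J := Num.bound (2 * (lam * A) `^ P / C).
have [K [c [r0 [/andP[r00 r01] cK cpair cQ]]]] := HJ J.
pose z := Num.max r0 y; pose r := (z + 1) / 2.
have z1 : z < 1 by rewrite gt_max r01.
have r0z : r0 <= z by rewrite le_max lexx.
have yz : y <= z by rewrite le_max lexx orbT.
have r1 : r < 1 by rewrite /r; lra.
have zr : z < r by rewrite /r; lra.
exists r; split => //; first exact: le_lt_trans zr.
rewrite leNgt; apply/negP => /ltW fA.
have rr0 : r0 <= r by lra.
have r_ge0 : 0 <= r by lra.
have := pairing_le_integral_mean P_ge1 Q_ge2 PQ fa r_ge0 r1 Pp (ltW lam0) A0 cK fA.
have := ler_wpM2l (ltW lam0) (cpair r rr0 (ltW r1)).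
have -> : lam * (kap * J%:R) = 2 * (C * J%:R).
  by rewrite /lam; field; rewrite gt_eqF.
have : 2 * (lam * A) `^ P < C * J%:R.
  rewrite [ltRHS]mulrC -ltr_pdivrMr//; apply: archi_boundP.
  by rewrite divr_ge0 ?mulr_ge0 ?powR_ge0 ?(ltW C0).
lra.
Qed.

(** A set of positive density is not contained in [{0}], so some coefficient is
    non-zero, and the corresponding monomial is a test polynomial. *)
Lemma growth_nonzero : (0 < limf_esup (integral_mean p f) 1%R^'-)%E.
Proof.
have [n an] : exists n, 0 < normc (a n).
  apply: contrapT => H; apply: (beta_dense_unbounded (n0 := 0)) aE => n /= an.
  exfalso; apply: H; exists n; rewrite lt_def normc_ge0 andbT.
  by apply: contraTneq an => ->; rewrite mulr0 ler10.
pose c k := if k == n then 1%:C * phase (a n) else 0 : R[i].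
have cn k : (n.+1 <= k)%N -> c k = 0 by rewrite /c => /gtn_eqF ->.
pose v := 2^-1 ^+ n * normc (a n).
have v0 : 0 < v by rewrite mulr_gt0// exprn_gt0.
apply: (@lt_le_trans _ _ (v / 8)%:E); first by rewrite lte_fin divr_gt0.
apply: limf_esup_at_left_ge => y y1.
pose z := Num.max (2^-1) y; pose r := (z + 1) / 2.
have z1 : z < 1 by rewrite gt_max y1 andbT; lra.
have hz : 2^-1 <= z by rewrite le_max lexx.
have yz : y <= z by rewrite le_max lexx orbT.
have r1 : r < 1 by rewrite /r; lra.
have zr : z < r by rewrite /r; lra.
have r0 : 0 <= r by lra.
exists r; split => //; first exact: le_lt_trans zr.
apply: (integral_mean_ge P_ge1 Q_ge2 PQ fa r0 r1 Pp v0 cn).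
  rewrite big_ord_recr/= big1 ?add0r => [|i _]; last first.
    by rewrite /c ltn_eqF// conjc0 !mulr0.
  rewrite /c eqxx Re_mul_phase mul1r ler_wpM2r ?normc_ge0//.
  by rewrite lerXn2r ?nnegrE//; lra.
rewrite -[leRHS](circle_avg_cst 1); apply: le_circle_avg.
- apply: bounded_measurable_normc_powR (ltW Q_gt0) _.
  exact: cbounded_measurable_trig_poly.
- exact: bounded_measurable_cst.
move=> t _; apply: (@le_trans _ _ (1 `^ Q)); last by rewrite powR1.
apply: ge0_ler_powR;
  rewrite ?nnegrE ?normc_ge0 ?(ltW Q_gt0)//.
apply: le_trans (normc_trig_poly_le _ _ _) _.
rewrite big_ord_recr/= big1 ?add0r => [|i _]; last first.
  by rewrite /c ltn_eqF// Normc.normc0.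
by rewrite /c eqxx mul1r normc_phase_le1.
Qed.

End growth.

Theorem theorem4p5 (R : realType) (alpha gamma : R) (p : \bar R) (q : R)
    (f : CC R -> CC R)
    (gamma_gt0 : 0 < gamma) (gamma_lt1 : gamma < 1)
    (p_gt1 : (1%E < p)%E) (pq : hoelder_conjugate p = q%:E)
    (fhc : U_beta_frequently_hypercyclic gamma (taylor_shift alpha) f) :
  (alpha < (1 - gamma) / Num.max 2 q ->
    (0 < limf_esup
      (fun r : R => ((1 - r) `^ ((1 - gamma) / Num.max 2 q - alpha))%:E
                    * integral_mean p f r) 1%R^'-)%E) /\
  (alpha = (1 - gamma) / Num.max 2 q ->
    limf_esup (integral_mean p f) 1%R^'- = +oo%E) /\
  ((1 - gamma) / Num.max 2 q < alpha ->
    (0 < limf_esup (integral_mean p f) 1%R^'-)%E).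
Proof.
have [P_ge1 Q_ge2 PQ Pp] := conjugate_exponents p_gt1 pq.
have [a fa aE] := hypercyclic_coef fhc.
split.
  by move=> _; exact: growth_power P_ge1 Q_ge2 PQ Pp gamma_gt0 gamma_lt1 fa aE.
split; first exact: growth_critical P_ge1 Q_ge2 PQ Pp gamma_gt0 gamma_lt1 fa aE.
move=> _; exact: growth_nonzero P_ge1 Q_ge2 PQ Pp fa aE.
Qed.
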